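(* Let $\mathcal{G}$ be a minimal purely infinite groupoid. If $\mathcal{G}$ has property TR, then the AH conjecture holds for $\mathcal{G}$, i.e. there is an exact sequence $$H_0(\mathcal{G})\otimes\mathbb{Z}_2\xrightarrow{\ j\ }[[\mathcal{G}]]_{\mathrm{ab}}\xrightarrow{\ I\ }H_1(\mathcal{G})\longrightarrow0 ;$$ especially, if $H_0(\mathcal{G})$ is $2$-divisible, then $[[\mathcal{G}]]_{\mathrm{ab}}\cong H_1(\mathcal{G})$. Here $I$ is the index map and $j$ is the homomorphism described in the context.
   Context: An étale groupoid is a second countable locally compact Hausdorff groupoid whose range map is a local homeomorphism; $s,r$ are the source and range maps, $\mathcal{G}^{(0)}$ is the unit space. $\mathcal{G}$ is essentially principal if the interior of $\{g: r(g)=s(g)\}$ is $\mathcal{G}^{(0)}$; minimal if every orbit $r(s^{-1}(x))$ is dense in $\mathcal{G}^{(0)}$. A $\mathcal{G}$-set is a subset $U\subset\mathcal{G}$ with $r|U,s|U$ injective; for $U$ open, $\theta(U)=(r|U)\circ(s|U)^{-1}:s(U)\to r(U)$. Purely infinite: let $\mathcal{G}$ be an essentially principal étale groupoid whose unit space is a Cantor set (compact, metrizable, totally disconnected, no isolated points). A clopen $A\subset\mathcal{G}^{(0)}$ is properly infinite if there are compact open $\mathcal{G}$-sets $U,V$ with $s(U)=s(V)=A$, $r(U)\cup r(V)\subset A$, $r(U)\cap r(V)=\emptyset$. $\mathcal{G}$ is purely infinite if every clopen $A\subset\mathcal{G}^{(0)}$ is properly infinite. The topological full group $[[\mathcal{G}]]$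 is the group of homeomorphisms of $\mathcal{G}^{(0)}$ of the form $\theta(U)$ with $U$ a compact open $\mathcal{G}$-set (such $U$ is unique). $\Gamma_{\mathrm{ab}}$ is the abelianization of $\Gamma$; $\mathbb{Z}_2$ is the cyclic group of order 2. Homology: $C_c(X,\mathbb{Z})$ denotes continuous compactly supported $\mathbb{Z}$-valued functions; a local homeomorphism $\pi:X\to Y$ induces $\pi_*(f)(y)=\sum_{\pi(x)=y}f(x)$. Let $\mathcal{G}^{(n)}$ be the space of composable $n$-strings ($s(g_i)=r(g_{i+1})$), with $d_0,\dots,d_n:\mathcal{G}^{(n)}\to\mathcal{G}^{(n-1)}$ given by dropping $g_1$ ($i=0$), multiplying $g_ig_{i+1}$ ($1\le i\le n-1$), dropping $g_n$ ($i=n$); for $n=1$, $d_0=s,d_1=r$. With $\partial_n=\sum_i(-1)^id_{i*}$, $H_n(\mathcal{G})$ is the $n$-th homology of $(C_c(\mathcal{G}^{(n)},\mathbb{Z}),\partial_n)$. Index map: $I:[[\mathcal{G}]]\to H_1(\mathcal{G})$, $I(\theta(U))=[1_U]$; it is a homomorphism and so factors through $[[\mathcal{G}]]_{\mathrm{ab}}$ (same symbol). $[[\mathcal{G}]]_0=\ker I\subset[[\mathcal{G}]]$. Property TR: a transposition is an element $\tau\in[[\mathcal{G}]]$ with $\tau^2=1$ and $\{x:\tau(x)=x\}$ clopen (transpositions lie in $[[\mathcal{G}]]_0$). $\mathcal{G}$ has property TR if $[[\mathcal{G}]]_0$ is generated by transpositions. The map $j$: for a compact open $\mathcal{G}$-set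 $U$ with $r(U)\cap s(U)=\emptyset$ let $\tau_U\in[[\mathcal{G}]]$ be $\theta(U)$ on $s(U)$, $\theta(U)^{-1}$ on $r(U)$, and the identity elsewhere. For $f\in C(\mathcal{G}^{(0)},\mathbb{Z})$, let $A=\{x: f(x)\text{ odd}\}$, choose compact open $\mathcal{G}$-sets $U_1,\dots,U_n$ with $r(U_i)\cap s(U_i)=\emptyset$ such that the $s(U_i)$ form a clopen partition of $A$; then $j([f]\otimes\bar1)$ is the class of $\tau_{U_1}\cdots\tau_{U_n}$. (That this is a well-defined homomorphism is part of the assertion.) *)

(* Defs.v *)
From HB Require Import structures.
From mathcomp Require Import all_boot all_order all_algebra.
From mathcomp Require Import freeg ring.
From mathcomp Require Import all_classical reals topology_theory.topology.

Set Implicit Arguments.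
Unset Strict Implicit.
Unset Printing Implicit Defensive.

Import Order.TTheory GRing.Theory Num.Theory.

Local Open Scope classical_set_scope.
Local Open Scope quotient_scope.
Local Open Scope ring_scope.

Definition zmod_generated (V : zmodType) (S : set V) : {pred V} :=
  fun v => `[< smallest (fun H : set V => H 0 /\ forall x y, H x -> H y -> H (x - y))
                        S v >].

Section ZmodGenerated.
Variables (V : zmodType) (S : set V).

Lemma zmod_generated_closed : zmod_closed (zmod_generated S).
Proof.
split=> [|x y]; first by apply/asboolP=> H [[]].
rewrite !unfold_in => /asboolP xS /asboolP yS; apply/asboolP=> H HS.
by apply: HS.1.2; [exact: xS | exact: yS].
Qed.

HB.instance Definition _ :=
  GRing.isZmodClosed.Build V (zmod_generated S) zmod_generated_closed.

End ZmodGenerated.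

(** The tensor product over the integers: the free abelian group on [A * B]
    modulo the subgroup generated by the bilinearity relations. *)
Section Tensor.
Variables A B : zmodType.

Let free (a : A) (b : B) : {freeg (A * B) / int} := [freeg [:: (1%:Z, (a, b))]].

Definition bilinear_relations : set {freeg (A * B) / int} :=
  [set v | (exists a a' b, v = free (a + a') b - free a b - free a' b)
        \/ (exists a b b', v = free a (b + b') - free a b - free a b')].

Definition tensor := Quotient.quot (zmod_generated bilinear_relations).

HB.instance Definition _ := GRing.Zmodule.on tensor.

Definition tens (a : A) (b : B) : tensor :=
  \pi_(Quotient.quot (zmod_generated bilinear_relations)) (free a b).

End Tensor.

Definition two_divisible (A : zmodType) := forall a : A, exists b, a = b *+ 2.

Definition subgroup (Gam : groupType) (H : set Gam) :=
  H 1%g /\ forall x y, H x -> H y -> H (x * y^-1)%g.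

Definition group_generated (Gam : groupType) (S : set Gam) : set Gam :=
  smallest (@subgroup Gam) S.

Section Abelianization.
Variable Gam : groupType.
Local Open Scope group_scope.

Definition derived_subgroup : set Gam :=
  group_generated [set z | exists x y, z = [~ x, y]].

Lemma derived1 : derived_subgroup 1.
Proof. by move=> H [[]]. Qed.

Lemma derivedMV x y :
  derived_subgroup x -> derived_subgroup y -> derived_subgroup (x * y^-1).
Proof. by move=> dx dy H HS; apply: HS.1.2; [exact: dx | exact: dy]. Qed.

Lemma derivedV x : derived_subgroup x -> derived_subgroup x^-1.
Proof. by move=> dx; rewrite -[_^-1]mul1g; apply: derivedMV => //; apply: derived1. Qed.

Lemma derivedM x y :
  derived_subgroup x -> derived_subgroup y -> derived_subgroup (x * y).
Proof. by move=> dx /derivedV dy; rewrite -[y]invgK; apply: derivedMV. Qed.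

Lemma derivedR x y : derived_subgroup [~ x, y].
Proof. by move=> H [_]; apply; exists x, y. Qed.

Lemma derivedJ x y : derived_subgroup x -> derived_subgroup (x ^ y).
Proof.
move=> dx; have -> : x ^ y = x * [~ x, y] by rewrite commgEl mulgA mulgV mul1g.
by apply: derivedM => //; apply: derivedR.
Qed.

Definition ab_equiv (x y : Gam) := `[< derived_subgroup (x^-1 * y) >].

Lemma ab_equiv_is_equiv : equiv_class_of ab_equiv.
Proof.
split=> [x|x y|y x z].
- by apply/asboolP; rewrite mulVg; apply: derived1.
- by apply/asboolP/asboolP => /derivedV; rewrite invgM invgK.
- move=> /asboolP xy /asboolP yz; apply/asboolP.
  by have := derivedM xy yz; rewrite -mulgA mulVKg.
Qed.

Canonical ab_equiv_equiv := EquivRelPack ab_equiv_is_equiv.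
Canonical ab_equiv_encModRel := defaultEncModRel ab_equiv.

Definition abelianization := {eq_quot ab_equiv}.

HB.instance Definition _ : EqQuotient Gam ab_equiv abelianization :=
  EqQuotient.on abelianization.
HB.instance Definition _ := Choice.on abelianization.

Definition ab_zero : abelianization := lift_cst abelianization 1.
Definition ab_opp := lift_op1 abelianization (fun x : Gam => x^-1).
Definition ab_add := lift_op2 abelianization (fun x y : Gam => x * y).

Canonical pi_ab_zero_morph := PiConst ab_zero.

Lemma ab_equivP x y :
  reflect (\pi_abelianization x = \pi_abelianization y) (ab_equiv x y).
Proof. by apply: (iffP idP) => [|/eqmodP //]; move=> h; apply/eqmodP. Qed.

Lemma ab_swap x y : \pi_abelianization (x * y) = \pi_abelianization (y * x).
Proof.
apply/ab_equivP/asboolP.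
have -> : (x * y)^-1 * (y * x) = [~ y, x] by rewrite commgEl /conjg invgM !mulgA.
exact: derivedR.
Qed.

Lemma pi_ab_opp : {morph \pi_abelianization : x / x^-1 >-> ab_opp x}.
Proof.
move=> x; unlock ab_opp; apply/ab_equivP/asboolP.
case: piP => y /ab_equivP/asboolP xy; rewrite invgK.
have -> : x * y^-1 = ((x^-1 * y) ^ x^-1)^-1.
  by rewrite /conjg invgK !mulgA mulgV mul1g invgM invgK.
by apply: derivedV; apply: derivedJ.
Qed.
Canonical pi_ab_opp_morph := PiMorph1 pi_ab_opp.

Lemma pi_ab_add : {morph \pi_abelianization : x y / x * y >-> ab_add x y}.
Proof.
move=> x y; unlock ab_add; apply/ab_equivP/asboolP.
case: piP => x' /ab_equivP/asboolP xx'; case: piP => y' /ab_equivP/asboolP yy'.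
have -> : (x * y)^-1 * (x' * y') = ((x^-1 * x') ^ y) * (y^-1 * y').
  by rewrite /conjg invgM !mulgA mulgK.
by apply: derivedM => //; apply: derivedJ.
Qed.
Canonical pi_ab_add_morph := PiMorph2 pi_ab_add.

Lemma ab_addA : associative ab_add.
Proof. by elim/quotW=> x; elim/quotW=> y; elim/quotW=> z; rewrite !piE mulgA. Qed.

Lemma ab_addC : commutative ab_add.
Proof. by elim/quotW=> x; elim/quotW=> y; rewrite !piE ab_swap. Qed.

Lemma ab_add0 : left_id ab_zero ab_add.
Proof. by elim/quotW=> x; rewrite !piE mul1g. Qed.

Lemma ab_addN : left_inverse ab_zero ab_opp ab_add.
Proof. by elim/quotW=> x; rewrite !piE mulVg. Qed.

HB.instance Definition _ :=
  GRing.isZmodule.Build abelianization ab_addA ab_addC ab_add0 ab_addN.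

Definition abel (x : Gam) : abelianization := \pi x.

Lemma abelM x y : abel (x * y) = (abel x + abel y)%R.
Proof. by rewrite /abel !piE. Qed.

End Abelianization.

HB.instance Definition _ := hasNbhs.Build int principal_filter.
HB.instance Definition _ := Discrete_ofNbhs.Build int erefl.

Definition homeomorphism (X Y : topologicalType) (f : X -> Y) :=
  continuous f /\ exists g : Y -> X, [/\ continuous g, cancel f g & cancel g f].

Definition local_homeomorphism (X Y : topologicalType) (f : X -> Y) :=
  forall x, exists U : set X, [/\ open U, U x, open (f @` U) &
    exists g : Y -> X, [/\ {in U, cancel f g}, {within U, continuous f}
                         & {within f @` U, continuous g}]].

Definition metrizable (X : topologicalType) :=
  exists (R : realType) (d : X -> X -> R),
    [/\ forall x y, (d x y = 0) <-> (x = y),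
        forall x y, d x y = d y x,
        forall x y z, d x z <= d x y + d y z &
        forall x (A : set X),
          nbhs x A <-> exists2 e : R, 0 < e & [set y | d x y < e] `<=` A].

Definition cantor_set (X : topologicalType) :=
  [/\ compact [set: X], metrizable X, totally_disconnected [set: X]
    & isolated [set: X] = set0].

Lemma compact_fibre_finite (X Y : topologicalType) (f : X -> Y) (K : set X) y :
  (forall x, exists U : set X, [/\ open U, U x & set_inj U f]) ->
  closed (f @^-1` [set y]) -> compact K -> finite_set (K `&` f @^-1` [set y]).
Proof.
move=> finj cf cK; set A := _ `&` _.
have cA : compact A by apply: compact_closedI.
have [U HU] := choice finj.
pose F : set_system (set X) :=
  filter_from (@finite_set X) (fun D => [set S | D `<=` S]).
have FF : Filter F.
  apply: filter_from_filter; first by exists set0.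
  move=> D E fD fE; exists (D `|` E); first by rewrite finite_setU.
  by move=> S DES; split=> x ?; apply: DES; [left | right].
have [x Ax|D fD AD] := (compact_near_coveringP A).1 cA _ F
    (fun S x => A x -> S x) FF; last first.
  by apply: sub_finite_set fD => x Ax; apply: (AD D).
have [oU Ux inj] := HU x.
exists (U x, [set S | S x]).
  split; first exact: open_nbhs_nbhs.
  by exists [set x] => // S; apply.
move=> [x' S] [/= Ux' Sx] Ax'; suff -> : x' = x by [].
by apply: inj; rewrite ?inE //; rewrite Ax.2 Ax'.2.
Qed.

Section LocalHomeo.
Variables (X Y : topologicalType) (f : X -> Y).
Hypothesis fL : local_homeomorphism f.

Lemma local_homeo_inj x : exists U : set X, [/\ open U, U x & set_inj U f].
Proof.
have [U [oU Ux _ [g [gK _ _]]]] := fL x.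
by exists U; split=> // a b aU bU fab; rewrite -(gK _ aU) fab gK.
Qed.

Lemma local_homeo_continuous : continuous f.
Proof.
move=> x; have [U [oU Ux _ [g [_ cf _]]]] := fL x.
by move: cf; rewrite continuous_open_subspace // => /(_ x); apply; rewrite inE.
Qed.

Lemma local_homeo_open V : open V -> open (f @` V).
Proof.
move=> oV; rewrite openE => _ [x Vx <-].
have [U [oU Ux ofU [g [gK _ cg]]]] := fL x.
have cgx : {for f x, continuous g}.
  move: cg; rewrite continuous_open_subspace //; apply.
  by rewrite inE; exists x.
have nUV : nbhs (g (f x)) (V `&` U).
  rewrite gK ?inE //; apply: open_nbhs_nbhs; split; [exact: openI | by split].
have nfU : nbhs (f x) (f @` U) by apply: open_nbhs_nbhs; split => //; exists x.
apply: filterS (filterI nfU (cgx _ nUV)) => _ [[z Uz <-] [Vgz _]].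
by exists z => //; move: Vgz; rewrite gK // inE.
Qed.

End LocalHomeo.

Lemma int_continuousP (X : topologicalType) (f : X -> int) :
  continuous f <-> forall x, \forall y \near x, f y = f x.
Proof.
split=> [cf x|lf x A]; first exact: (cf x [set f x]).
by rewrite nbhs_principalE => /principal_filterP Afx; apply: filterS (lf x) => y /= ->.
Qed.

Section CompactSupport.
Variable X : topologicalType.

Definition Cc_pred : {pred X -> int} :=
  fun f : X -> int => `[< continuous f /\ compact (closure [set x | f x != 0]) >].

Lemma CcP (f : X -> int) :
  reflect (continuous f /\ compact (closure [set x | f x != 0])) (f \in Cc_pred).
Proof. exact: asboolP. Qed.

Lemma Cc_zmod_closed : zmod_closed Cc_pred.
Proof.
split=> [|f g /CcP[cf kf] /CcP[cg kg]]; apply/CcP; split.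
- by apply/int_continuousP => x; near=> y.
- have -> : [set x | (0 : X -> int) x != 0] = set0.
    by apply/seteqP; split=> x //=; rewrite eqxx.
  by rewrite closure0; apply: compact0.
- apply/int_continuousP => x; near=> y; rewrite !fctE; congr (_ - _); near: y.
    exact: ((int_continuousP f).1 cf).
  exact: ((int_continuousP g).1 cg).
- apply: subclosed_compact (compactU kf kg) _; first exact: closed_closure.
  rewrite -closureU; apply: closure_subset => x /=; rewrite !fctE => fgx.
  by case: (eqVneq (f x) 0) => [fx0|]; [right; apply: contraNneq fgx => ->; rewrite fx0 subrr | left].
Unshelve. all: by end_near. Qed.

HB.instance Definition _ := GRing.isZmodClosed.Build _ Cc_pred Cc_zmod_closed.

Record Cc := MkCc { Cc_fun :> X -> int; _ : Cc_fun \in Cc_pred }.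

HB.instance Definition _ := [isSub for Cc_fun].
HB.instance Definition _ := [Choice of Cc by <:].
HB.instance Definition _ := [SubChoice_isSubZmodule of Cc by <:].

Lemma Cc_continuous (f : Cc) : continuous f.
Proof. by have /CcP[] := valP f. Qed.

Lemma Cc_compact (f : Cc) : compact (closure [set x | f x != 0]).
Proof. by have /CcP[] := valP f. Qed.

Lemma CcB (f g : Cc) x : (f - g) x = f x - g x.
Proof. by []. Qed.

Lemma indic_Cc (U : set X) :
  hausdorff_space X -> compact U -> open U -> (fun x : X => (x \in U)%:Z) \in Cc_pred.
Proof.
move=> hX kU oU; have cU := compact_closed hX kU; apply/CcP; split.
  apply/int_continuousP => x; have [Ux|nUx] := boolP (x \in U).
    apply: (filterS (P := U)); last by apply: open_nbhs_nbhs; split=> //; rewrite inE in Ux.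
    by move=> y Uy; rewrite mem_set.
  apply: (filterS (P := ~` U)).
    by move=> y Uy; rewrite memNset.
  by apply: open_nbhs_nbhs; split; [exact: closed_openC | rewrite notin_setE in nUx].
have -> : [set x | (x \in U)%:Z != 0] = U.
  apply/seteqP; split=> x /=; last by move=> Ux; rewrite mem_set.
  by case: (boolP (x \in U)) => //; rewrite inE.
by rewrite -(closure_id U).1.
Qed.

Definition indic (hX : hausdorff_space X) (U : set X) (kU : compact U) (oU : open U) : Cc :=
  MkCc (indic_Cc hX kU oU).

End CompactSupport.

(** The sum is over the finite support of [f] in the fibre; for a local
    homeomorphism [p] and [f] in [Cc X] that support is finite. *)
Definition pushforward (X Y : topologicalType) (p : X -> Y) (f : X -> int) : Y -> int :=
  fun y => \sum_(x \in p @^-1` [set y]) f x.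

Section Pushforward.
Variables (X Y : topologicalType) (p : X -> Y).
Hypothesis pinj : forall x, exists U : set X, [/\ open U, U x & set_inj U p].
Hypothesis pcont : continuous p.
Hypothesis hY : hausdorff_space Y.

Lemma pushforwardB (f g : Cc X) :
  pushforward p (f - g) = pushforward p f - pushforward p g.
Proof.
apply/funext => y; rewrite !fctE /pushforward.
set F := p @^-1` _.
have cF : closed F.
  by apply: closed_comp => [x _|]; [exact: pcont | exact/accessible_closed_set1/hausdorff_accessible].
set K : set X := closure [set x | f x != 0 :> int] `|` closure [set x | g x != 0].
have fin : finite_set (K `&` F).
  by apply: compact_fibre_finite => //; apply: compactU; exact: Cc_compact.
have sub h : (forall x, ~ K x -> h x = 0 :> int) ->
    \sum_(x \in F) h x = \sum_(x \in K `&` F) h x.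
  move=> hK; symmetry; apply: fsbig_widen => [x []//|x [Fx nKF]].
  by apply: hK => Kx; apply: nKF.
have f0 x : ~ K x -> f x = 0.
  by move=> nK; apply/eqP/negPn/negP => fx; apply: nK; left; exact: subset_closure.
have g0 x : ~ K x -> g x = 0.
  by move=> nK; apply/eqP/negPn/negP => gx; apply: nK; right; exact: subset_closure.
rewrite !sub //; last by move=> x nK; rewrite CcB f0 // g0 // subrr.
by rewrite !fsbig_finite //= -sumrB.
Qed.

End Pushforward.

(** [gmul g h] is meaningful only when [src g = rng h]. The unit space is the
    type [units] of the elements of a subset of the space of arrows, with the
    subspace topology. *)
Record etale_groupoid := EtaleGroupoid {
  arrow :> topologicalType;
  units : set arrow;
  src : arrow -> units;
  rng : arrow -> units;
  gmul : arrow -> arrow -> arrow;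
  ginv : arrow -> arrow;
  src_unit : forall x : units, src (\val x) = x;
  rng_unit : forall x : units, rng (\val x) = x;
  src_gmul : forall g h, src g = rng h -> src (gmul g h) = src h;
  rng_gmul : forall g h, src g = rng h -> rng (gmul g h) = rng g;
  gmulA : forall g h k, src g = rng h -> src h = rng k ->
    gmul g (gmul h k) = gmul (gmul g h) k;
  gmul_src : forall g, gmul g (\val (src g)) = g;
  gmul_rng : forall g, gmul (\val (rng g)) g = g;
  src_ginv : forall g, src (ginv g) = rng g;
  rng_ginv : forall g, rng (ginv g) = src g;
  gmulgV : forall g, gmul g (ginv g) = \val (rng g);
  gmulVg : forall g, gmul (ginv g) g = \val (src g);
  gmul_continuous :
    {within [set p : arrow * arrow | src p.1 = rng p.2],
     continuous (fun p => gmul p.1 p.2)};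
  ginv_continuous : continuous ginv;
  arrow_second_countable : @second_countable arrow;
  arrow_locally_compact : locally_compact [set: arrow];
  arrow_hausdorff : hausdorff_space arrow;
  rng_local_homeo : local_homeomorphism rng
}.

Arguments units : clear implicits.

Notation unit_space G := (set_type (units G)).

Definition essentially_principal (G : etale_groupoid) :=
  interior [set g : G | rng g = src g] = units G.

Definition minimal_groupoid (G : etale_groupoid) :=
  forall x : unit_space G, dense (@rng G @` (@src G @^-1` [set x])).

(** A [bisection] is what the literature on these groups calls a G-set; it is
    not required to be open. *)
Definition bisection (G : etale_groupoid) (U : set G) :=
  set_inj U (@rng G) /\ set_inj U (@src G).

Definition compact_open_bisection (G : etale_groupoid) (U : set G) :=
  [/\ compact U, open U & bisection U].

Definition properly_infinite (G : etale_groupoid) (A : set (unit_space G)) :=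
  exists U V : set G,
    [/\ compact_open_bisection U, compact_open_bisection V,
        @src G @` U = A /\ @src G @` V = A,
        (@rng G @` U) `|` (@rng G @` V) `<=` A &
        (@rng G @` U) `&` (@rng G @` V) = set0].

Record cantor_groupoid := CantorGroupoid {
  etale_of :> etale_groupoid;
  cantor_essentially_principal : essentially_principal etale_of;
  cantor_units : cantor_set (unit_space etale_of)
}.

Definition purely_infinite (G : cantor_groupoid) :=
  forall A : set (unit_space G), clopen A -> properly_infinite A.

Section EtaleTheory.
Variable G : etale_groupoid.
Local Notation X := (unit_space G).
Local Notation s := (@src G).
Local Notation r := (@rng G).
Local Notation mul := (@gmul G).
Local Notation inv := (@ginv G).
Implicit Types (g h k : G) (x y : X).

Definition composable : set (G * G) := [set p | s p.1 = r p.2].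

Lemma ginvK : involutive inv.
Proof.
move=> g; have si : s (inv (inv g)) = s g by rewrite src_ginv rng_ginv.
rewrite -[LHS]gmul_src si -gmulVg gmulA ?si ?rng_ginv ?src_ginv //.
by rewrite gmulVg src_ginv gmul_rng.
Qed.

Lemma gmul_sub_continuous :
  continuous (fun p : composable => mul (\val p).1 (\val p).2).
Proof. exact: ((subspace_sigL_continuousP _ _).1 (@gmul_continuous G)). Qed.

Lemma rng_continuous : continuous r.
Proof. exact/local_homeo_continuous/rng_local_homeo. Qed.

Lemma src_continuous : continuous s.
Proof.
have -> : s = r \o inv by apply/funext => g /=; rewrite rng_ginv.
by move=> g; apply: continuous_comp; [exact: ginv_continuous | exact: rng_continuous].
Qed.

Lemma rng_open V : open V -> open (r @` V).
Proof. exact/local_homeo_open/rng_local_homeo. Qed.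

Lemma ginv_image V : inv @` V = inv @^-1` V.
Proof.
apply/seteqP; split=> [_ [g Vg <-] /=|g Vg]; first by rewrite ginvK.
by exists (inv g) => //; rewrite ginvK.
Qed.

Lemma ginv_open V : open V -> open (inv @^-1` V).
Proof. by move=> oV; apply: open_comp => // g _; exact: ginv_continuous. Qed.

Lemma src_open V : open V -> open (s @` V).
Proof.
move=> oV; have -> : s @` V = r @` (inv @^-1` V).
  apply/seteqP; split=> _ [g Vg <-].
    by exists (inv g); rewrite /= ?ginvK ?rng_ginv.
  by exists (inv g); rewrite ?src_ginv.
exact/rng_open/ginv_open.
Qed.

Lemma val_units_continuous : continuous (\val : X -> G).
Proof. exact: initial_continuous. Qed.

Lemma unit_spaceP g : units G g -> \val (r g) = g.
Proof. by move=> /mem_set Gg; have /= := rng_unit (exist _ g Gg : X) => ->. Qed.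

Lemma units_val x : units G (\val x).
Proof. exact: set_valP. Qed.

Lemma unit_space_hausdorff : hausdorff_space X.
Proof.
move=> x y xy; apply: val_inj; apply: (@arrow_hausdorff G) => A B nA nB.
have [z [Az Bz]] := xy _ _ (val_units_continuous nA) (val_units_continuous nB).
by exists (\val z).
Qed.

Lemma units_open : open (units G).
Proof.
rewrite openE => u Gu.
have [W [oW Wu Winj]] := local_homeo_inj (@rng_local_homeo G) u.
pose W' := W `&` (fun g => \val (r g)) @^-1` W.
have oW' : open W'.
  apply: openI => //; apply: open_comp => // g _.
  by apply: continuous_comp; [exact: rng_continuous | exact: val_units_continuous].
have : nbhs u W'.
  apply: open_nbhs_nbhs; split=> //; split=> //=; by rewrite unit_spaceP.
apply: filterS => g [Wg Wrg]; have -> : g = \val (r g).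
  by apply: Winj; rewrite ?inE // rng_unit.
exact: units_val.
Qed.

Lemma bisection_inv U : compact_open_bisection U ->
  compact_open_bisection (inv @^-1` U).
Proof.
move=> [kU oU [ri si]]; split; last split.
- rewrite -ginv_image; apply: continuous_compact => //.
  by apply: continuous_subspaceT; exact: ginv_continuous.
- exact: ginv_open.
- move=> g h Ug Uh gh; apply: (can_inj ginvK); apply: si; rewrite ?inE //.
  + by rewrite inE in Ug.
  + by rewrite inE in Uh.
  + by rewrite !src_ginv.
- move=> g h Ug Uh gh; apply: (can_inj ginvK); apply: ri; rewrite ?inE //.
  + by rewrite inE in Ug.
  + by rewrite inE in Uh.
  + by rewrite !rng_ginv.
Qed.

Lemma open_section (p : G -> X) (U : set G) :
  (forall V, open V -> open (p @` V)) -> open U -> p @` U = setT ->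
  set_inj U p ->
  exists sg : X -> G, [/\ continuous sg, forall x, U (sg x) & cancel sg p].
Proof.
move=> pop oU pU pinj.
have [sg sgP] : {sg : X -> G & forall x, U (sg x) /\ p (sg x) = x}.
  apply: (@choice _ _ (fun x g => U g /\ p g = x)) => x.
  have : (p @` U) x by rewrite pU.
  by move=> [g Ug gx]; exists g.
exists sg; split=> [x A|x|x]; [|by case: (sgP x)..].
rewrite nbhsE => -[B [oB Bx] BA].
have oBU : open (p @` (B `&` U)) by apply/pop/openI.
apply: (filterS (P := p @` (B `&` U))).
  move=> _ [g [Bg Ug] <-] /=; apply: BA.
  by suff -> : sg (p g) = g; last (apply: pinj; rewrite ?inE; case: (sgP (p g))).
apply: open_nbhs_nbhs; split=> //; exists (sg x); last by case: (sgP x).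
by split=> //; case: (sgP x).
Qed.

End EtaleTheory.

Arguments composable : clear implicits.

(** [theta_of U f]: the map [f] extends [theta(U) : s(U) -> r(U)]. *)
Definition theta_of (G : etale_groupoid) (U : set G)
    (f : unit_space G -> unit_space G) :=
  forall g, U g -> f (src g) = rng g.

Definition full_bisection (G : etale_groupoid) (U : set G) :=
  [/\ compact_open_bisection U, @src G @` U = setT & @rng G @` U = setT].

Section FullGroup.
Variable G : cantor_groupoid.
Local Notation X := (unit_space G).
Local Notation s := (@src G).
Local Notation r := (@rng G).
Local Notation mul := (@gmul G).
Local Notation inv := (@ginv G).
Implicit Types (g h k : G) (x y : X) (U V : set G).

Lemma unit_space_compact : compact [set: X].
Proof. by case: (cantor_units G). Qed.

Lemma gmul_comp_continuous (T : topologicalType) (a b : T -> G) :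
  continuous a -> continuous b -> (forall t, s (a t) = r (b t)) ->
  continuous (fun t => mul (a t) (b t)).
Proof.
move=> ca cb ab.
pose psi t : composable G := exist _ (a t, b t) (mem_set (ab t)).
have cpsi : continuous psi.
  by apply: continuous_comp_initial => t; apply: cvg_pair; [exact: ca | exact: cb].
move=> t; apply: (@continuous_comp _ _ _ psi
  (fun p : composable G => mul (\val p).1 (\val p).2)); first exact: cpsi.
exact: gmul_sub_continuous.
Qed.

Lemma section_bisection_compact U : open U -> bisection U -> r @` U = setT ->
  compact U.
Proof.
move=> oU [ri si] rU.
have [sg [csg Usg sgK]] := open_section (@rng_open G) oU rU ri.
have -> : U = sg @` [set: X].
  apply/seteqP; split=> [g Ug|_ [x _ <-] //]; exists (r g) => //.
  by apply: ri; rewrite ?inE // sgK.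
apply: continuous_compact; last exact: unit_space_compact.
exact: continuous_subspaceT.
Qed.

Lemma full_bisectionI U : open U -> bisection U -> s @` U = setT ->
  r @` U = setT -> full_bisection U.
Proof. by move=> oU bU sU rU; split=> //; split=> //; apply: section_bisection_compact. Qed.

Lemma full_bisection_inv U : full_bisection U -> full_bisection (inv @^-1` U).
Proof.
move=> [cU sU rU]; split; first exact: bisection_inv.
  apply/seteqP; split=> // x _; have : (r @` U) x by rewrite rU.
  by move=> [g Ug <-]; exists (inv g); rewrite /= ?ginvK // src_ginv.
apply/seteqP; split=> // x _; have : (s @` U) x by rewrite sU.
by move=> [g Ug <-]; exists (inv g); rewrite /= ?ginvK // rng_ginv.
Qed.

Definition bisection_mul U V : set G :=
  [set k | exists g h, [/\ U g, V h, s g = r h & k = mul g h]].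

Lemma bisection_mul_open U V :
  full_bisection U -> open V -> open (bisection_mul U V).
Proof.
move=> [[_ oU [ri si]] sU rU] oV.
have [sg [csg Usg sgK]] := open_section (@rng_open G) oU rU ri.
have srk k : s (inv (sg (r k))) = r k by rewrite src_ginv sgK.
have -> : bisection_mul U V = (fun k => mul (inv (sg (r k))) k) @^-1` V.
  apply/seteqP; split=> k /=.
    move=> [g [h [Ug Vh gh ->]]]; rewrite rng_gmul //.
    have -> : sg (r g) = g by apply: ri; rewrite ?inE // sgK.
    by rewrite gmulA ?src_ginv // gmulVg gh gmul_rng.
  move=> Vk; exists (sg (r k)), (mul (inv (sg (r k))) k); split=> //.
    by rewrite rng_gmul // rng_ginv.
  by rewrite gmulA // ?rng_ginv // gmulgV sgK gmul_rng.
apply: open_comp => // k _; apply: gmul_comp_continuous => //; last by move=> ?; apply: cvg_id.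
move=> {}k; apply: continuous_comp; last exact: ginv_continuous.
by apply: continuous_comp; [exact: rng_continuous | exact: csg].
Qed.

Lemma full_bisection_mul U V :
  full_bisection U -> full_bisection V -> full_bisection (bisection_mul U V).
Proof.
move=> fU [[_ oV [riV siV]] sV rV]; have [[_ oU [riU siU]] sU rU] := fU.
apply: full_bisectionI; first exact: bisection_mul_open.
- split=> _ _ /set_mem[g [h [Ug Vh gh ->]]] /set_mem[g' [h' [Ug' Vh' gh' ->]]].
    rewrite !rng_gmul // => rr; have e : g = g' by apply: riU; rewrite ?inE.
    by rewrite e; congr mul; apply: riV; rewrite ?inE // -gh -gh' e.
  rewrite !src_gmul // => ss; have e : h = h' by apply: siV; rewrite ?inE.
  by rewrite e; congr (mul _ _); apply: siU; rewrite ?inE // gh gh' e.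
- apply/seteqP; split=> // x _; have : (s @` V) x by rewrite sV.
  move=> [h Vh <-]; have : (s @` U) (r h) by rewrite sU.
  by move=> [g Ug gh]; exists (mul g h); [exists g, h | rewrite src_gmul].
- apply/seteqP; split=> // x _; have : (r @` U) x by rewrite rU.
  move=> [g Ug <-]; have : (r @` V) (s g) by rewrite rV.
  by move=> [h Vh gh]; exists (mul g h); [exists g, h | rewrite rng_gmul].
Qed.

Lemma full_bisection_units : full_bisection (units G).
Proof.
apply: full_bisectionI; first exact: units_open.
- split=> g h /set_mem Gg /set_mem Gh gh.
    by rewrite -[g]unit_spaceP // gh unit_spaceP.
  rewrite -[g]unit_spaceP // -[h]unit_spaceP //; congr (\val _).
  by rewrite -[r g]src_unit -[r h]src_unit !unit_spaceP.
- by apply/seteqP; split=> // x _; exists (\val x); rewrite ?src_unit //; exact: units_val.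
- by apply/seteqP; split=> // x _; exists (\val x); rewrite ?rng_unit //; exact: units_val.
Qed.

Lemma theta_sub U V f : full_bisection U -> full_bisection V ->
  theta_of U f -> theta_of V f -> U `<=` V.
Proof.
move=> fU fV Uf Vf g Ug; have [[_ _ [riU siU]] sU rU] := fU.
have [[_ oV _] sV _] := fV.
have srE a b : U a -> V b -> r a = r b -> s a = s b.
  move=> Ua Vb ab; have : (s @` U) (s b) by rewrite sU.
  move=> [c Uc cb]; have <- : c = a by apply: riU; rewrite ?inE // -Uf // cb Vf.
  exact: cb.
have subG : bisection_mul (inv @^-1` U) V `<=` units G.
  rewrite -(@cantor_essentially_principal G) => k Wk.
  have : nbhs k (bisection_mul (inv @^-1` U) V).
    apply: open_nbhs_nbhs; split=> //.
    by apply: bisection_mul_open => //; apply: full_bisection_inv.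
  apply: filterS => _ [a [b [Ua Vb ab ->]]] /=.
  rewrite rng_gmul // src_gmul // -src_ginv.
  have rab : r (inv a) = r b by rewrite rng_ginv.
  exact: (srE _ _ Ua Vb rab).
have : (s @` V) (s g) by rewrite sV.
move=> [h Vh sh]; have rh : r h = r g by rewrite -(Vf _ Vh) sh Uf.
have /subG Gk : bisection_mul (inv @^-1` U) V (mul (inv g) h).
  by exists (inv g), h; split; rewrite //= ?ginvK // src_ginv rh.
have ke : mul (inv g) h = \val (s g).
  by rewrite -[LHS]unit_spaceP // rng_gmul ?rng_ginv // src_ginv.
have -> : g = h; last by [].
by rewrite -[g]gmul_src -ke gmulA ?src_ginv ?rng_ginv // gmulgV -rh gmul_rng.
Qed.

(** Essential principality makes [U] unique among those giving [theta(U)]. *)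
Lemma theta_unique U V f : full_bisection U -> full_bisection V ->
  theta_of U f -> theta_of V f -> U = V.
Proof. by move=> fU fV Uf Vf; apply/seteqP; split; apply: (@theta_sub _ _ f). Qed.

Lemma theta_homeomorphism U f :
  full_bisection U -> theta_of U f -> homeomorphism f.
Proof.
move=> [[_ oU [riU siU]] sU rU] Uf.
have [sg [csg Usg sgK]] := open_section (@src_open G) oU sU siU.
have [rg [crg Urg rgK]] := open_section (@rng_open G) oU rU riU.
have fE : f = r \o sg by apply/funext => x /=; rewrite -Uf // sgK.
split.
  by rewrite fE => x; apply: continuous_comp; [exact: csg | exact: rng_continuous].
exists (s \o rg); split=> [x|x|x] /=.
- by apply: continuous_comp; [exact: crg | exact: src_continuous].
- rewrite fE /=; have -> : rg (r (sg x)) = sg x by apply: riU; rewrite ?inE.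
  exact: sgK.
- by rewrite Uf.
Qed.

Lemma theta_exists U : full_bisection U -> exists f, theta_of U f.
Proof.
move=> [[_ oU [riU siU]] sU rU].
have [sg [csg Usg sgK]] := open_section (@src_open G) oU sU siU.
exists (r \o sg) => g Ug /=; congr r.
by apply: siU; rewrite ?inE.
Qed.

(** The homeomorphisms of the unit space of the form [theta(U)]; being defined
    on all of the unit space and onto it forces [s(U) = r(U) = X]. The group
    law is composition. *)
Definition full_group_set : set (X -> X) :=
  [set f | homeomorphism f /\ exists2 U, full_bisection U & theta_of U f].

Definition full_group := set_type full_group_set.
HB.instance Definition _ := Choice.on full_group.

Lemma full_group_id : full_group_set id.
Proof.
have Uid : theta_of (units G) (id : X -> X).
  by move=> g Gg; rewrite -{1}[g]unit_spaceP // src_unit.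
split; last by exists (units G) => //; exact: full_bisection_units.
exact: theta_homeomorphism full_bisection_units Uid.
Qed.

Lemma theta_comp U V f f' : theta_of U f -> theta_of V f' ->
  theta_of (bisection_mul U V) (f \o f').
Proof.
move=> Uf Vf _ [g [h [Ug Vh gh ->]]] /=.
by rewrite src_gmul // rng_gmul // Vf // -gh Uf.
Qed.

Lemma full_group_comp f f' :
  full_group_set f -> full_group_set f' -> full_group_set (f \o f').
Proof.
move=> [_ [U fU Uf]] [_ [V fV Vf]].
have fUV := full_bisection_mul fU fV; have UVf := theta_comp Uf Vf.
by split; [exact: theta_homeomorphism fUV UVf | exists (bisection_mul U V)].
Qed.

Lemma full_group_inv f : full_group_set f ->
  exists f', [/\ full_group_set f', cancel f f' & cancel f' f].
Proof.
move=> [[_ [f' [_ fK f'K]]] [U fU Uf]]; exists f'.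
have fV := full_bisection_inv fU.
have Vf : theta_of (inv @^-1` U) f'.
  by move=> g Ug; rewrite -rng_ginv -Uf // src_ginv fK.
by split=> //; split; [exact: theta_homeomorphism fV Vf | exists (inv @^-1` U)].
Qed.

Definition full_one : full_group := exist _ id (mem_set full_group_id).

Definition full_mul (f f' : full_group) : full_group :=
  exist _ (\val f \o \val f') (mem_set (full_group_comp (set_valP f) (set_valP f'))).

Definition full_inv (f : full_group) : full_group :=
  let: exist f' f'P := cid (full_group_inv (set_valP f)) in
  exist _ f' (mem_set (let: And3 p _ _ := f'P in p)).

Lemma full_mulA : associative full_mul.
Proof. by move=> f f' f''; apply: val_inj. Qed.

Lemma full_mul1 : left_id full_one full_mul.
Proof. by move=> f; apply: val_inj. Qed.

Lemma full_mulr1 : right_id full_one full_mul.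
Proof. by move=> f; apply: val_inj. Qed.

Lemma full_mulV : left_inverse full_one full_inv full_mul.
Proof.
move=> f; apply: val_inj; rewrite /full_inv; case: cid => f' [/= _ fK _].
by apply/funext => x /=; rewrite fK.
Qed.

Lemma full_mulrV : right_inverse full_one full_inv full_mul.
Proof.
move=> f; apply: val_inj; rewrite /full_inv; case: cid => f' [/= _ _ f'K].
by apply/funext => x /=; rewrite f'K.
Qed.

HB.instance Definition _ :=
  isGroup.Build full_group full_mulA full_mul1 full_mulr1 full_mulV full_mulrV.

End FullGroup.

Arguments full_group : clear implicits.

(** [t] is the element [tau_U]: it is [theta(U)] on [s(U)], its inverse on
    [r(U)], and the identity elsewhere. *)
Definition is_tau (G : cantor_groupoid) (U : set G) (t : full_group G) :=
  [/\ forall g, U g -> \val t (src g) = rng g,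
      forall g, U g -> \val t (rng g) = src g &
      forall x, ~ (@src G @` U) x -> ~ (@rng G @` U) x -> \val t x = x].

Section Tau.
Variable G : cantor_groupoid.
Local Notation X := (unit_space G).
Local Notation s := (@src G).
Local Notation r := (@rng G).
Local Notation inv := (@ginv G).

Lemma tau_exists (U : set G) : compact_open_bisection U ->
  (s @` U) `&` (r @` U) = set0 -> exists t : full_group G, is_tau U t.
Proof.
move=> cU; have [kU oU [ri si]] := cU => sr0.
have sr g h : U g -> U h -> s g <> r h.
  move=> Ug Uh gh; suff : (s @` U `&` r @` U) (s g) by rewrite sr0.
  by split; [exists g | exists h].
pose D := s @` U `|` r @` U.
have cD : closed D.
  apply: compact_closed; first exact: unit_space_hausdorff.
  apply: compactU; apply: continuous_compact => //; apply: continuous_subspaceT.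
    exact: src_continuous.
  exact: rng_continuous.
pose E : set G := units G `&` (r @^-1` (~` D)).
have rE g : E g -> \val (r g) = g by move=> [Gg _]; exact: unit_spaceP.
have sE g : E g -> s g = r g by move=> Eg; rewrite -{1}[g]rE // src_unit.
have nE g h : E g -> U h -> r g <> s h /\ r g <> r h.
  move=> [_ nDg] Uh.
  by split=> gh; apply: nDg; rewrite gh; [left | right]; exists h.
pose W := U `|` (inv @^-1` U) `|` E.
have fW : full_bisection W.
  apply: full_bisectionI.
  - apply: openU; first by apply: openU => //; exact: ginv_open.
    apply: openI; first exact: units_open.
    by apply: open_comp => [g _|]; [exact: rng_continuous | exact: closed_openC].
  - split=> g h /set_mem[[Ug|Ug]|Eg] /set_mem[[Uh|Uh]|Eh] gh.
    + by apply: ri; rewrite ?inE.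
    + by case: (sr _ _ Uh Ug); rewrite gh src_ginv.
    + by case: (nE _ _ Eh Ug) => _ []; rewrite gh.
    + by case: (sr _ _ Ug Uh); rewrite -gh src_ginv.
    + by apply: (can_inj (@ginvK G)); apply: si; rewrite ?inE // !src_ginv.
    + by case: (nE _ _ Eh Ug) => -[]; rewrite src_ginv gh.
    + by case: (nE _ _ Eg Uh) => _ []; rewrite gh.
    + by case: (nE _ _ Eg Uh) => -[]; rewrite src_ginv gh.
    + by rewrite -[g]rE // gh rE.
    + by apply: si; rewrite ?inE.
    + by case: (sr _ _ Ug Uh); rewrite gh rng_ginv.
    + by case: (nE _ _ Eh Ug) => -[]; rewrite gh sE.
    + by case: (sr _ _ Uh Ug); rewrite rng_ginv -gh.
    + by apply: (can_inj (@ginvK G)); apply: ri; rewrite ?inE // !rng_ginv.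
    + by case: (nE _ _ Eh Ug) => _ []; rewrite rng_ginv gh sE.
    + by case: (nE _ _ Eg Uh) => -[]; rewrite -gh sE.
    + by case: (nE _ _ Eg Uh) => _ []; rewrite rng_ginv -gh sE.
    + by rewrite -[g]rE // -sE // gh sE // rE.
  - apply/seteqP; split=> // x _; have [[[g Ug <-]|[g Ug <-]]|nD] := pselect (D x).
    + by exists g => //; left; left.
    + by exists (inv g); [left; right; rewrite /= ginvK | rewrite src_ginv].
    + exists (\val x); last exact: src_unit.
      by right; split; [exact: units_val | rewrite /= rng_unit].
  - apply/seteqP; split=> // x _; have [[[g Ug <-]|[g Ug <-]]|nD] := pselect (D x).
    + by exists (inv g); [left; right; rewrite /= ginvK | rewrite rng_ginv].
    + by exists g => //; left; left.
    + exists (\val x); last exact: rng_unit.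
      by right; split; [exact: units_val | rewrite /= rng_unit].
have [f Wf] := theta_exists fW.
have fP : full_group_set f by split; [exact: theta_homeomorphism fW Wf | exists W].
exists (exist _ f (mem_set fP)); split=> /= [g Ug|g Ug|x nsx nrx].
- by apply: Wf; left; left.
- by rewrite -src_ginv Wf ?rng_ginv //; left; right; rewrite /= ginvK.
- rewrite -{1}[x]src_unit Wf ?rng_unit //; right; split; first exact: units_val.
  by rewrite /= rng_unit => -[].
Qed.

End Tau.

Section Homology.
Variable G : etale_groupoid.
Local Notation X := (unit_space G).
Local Notation G2 := (set_type (composable G)).
Local Notation s := (@src G).
Local Notation r := (@rng G).

(** A composable pair is [(g1, g2)] with [src g1 = rng g2]; [face0] drops [g1],
    [face1] multiplies, [face2] drops [g2]. *)
Definition face0 (p : G2) : G := (\val p).2.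
Definition face1 (p : G2) : G := gmul (\val p).1 (\val p).2.
Definition face2 (p : G2) : G := (\val p).1.

Definition boundary1 (f : G -> int) : X -> int :=
  pushforward s f - pushforward r f.

Definition boundary2 (f : G2 -> int) : G -> int :=
  pushforward face0 f - pushforward face1 f + pushforward face2 f.

Lemma composable_rng (p : G2) : s (\val p).1 = r (\val p).2.
Proof. exact: set_valP p. Qed.

Lemma rng_inj_loc g : exists U : set G, [/\ open U, U g & set_inj U r].
Proof. exact/local_homeo_inj/rng_local_homeo. Qed.

Lemma src_inj_loc g : exists U : set G, [/\ open U, U g & set_inj U s].
Proof.
have [U [oU Ug Uinj]] := rng_inj_loc (ginv g).
exists (@ginv G @^-1` U); split=> //; first exact: ginv_open.
move=> a b Ua Ub ab; apply: (can_inj (@ginvK G)).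
by apply: Uinj; rewrite ?inE; [exact: set_mem Ua | exact: set_mem Ub | rewrite !rng_ginv].
Qed.

Lemma face0_continuous : continuous face0.
Proof.
move=> p; apply: (@continuous_comp _ _ _ (\val : G2 -> G * G) snd).
  exact: initial_continuous.
exact: cvg_snd.
Qed.

Lemma face2_continuous : continuous face2.
Proof.
move=> p; apply: (@continuous_comp _ _ _ (\val : G2 -> G * G) fst).
  exact: initial_continuous.
exact: cvg_fst.
Qed.

Lemma face1_continuous : continuous face1.
Proof. exact: gmul_sub_continuous. Qed.

Lemma composable_eq (p q : G2) : face2 p = face2 q -> face0 p = face0 q -> p = q.
Proof.
move=> pq1 pq2; apply: val_inj; move: pq1 pq2; rewrite /face2 /face0.
by case: (\val p) (\val q) => [? ?] [? ?] /= -> ->.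
Qed.

Lemma face0_inj_loc p : exists U : set G2, [/\ open U, U p & set_inj U face0].
Proof.
have [U [oU Up Uinj]] := src_inj_loc (face2 p).
exists (face2 @^-1` U); split=> //.
  by apply: open_comp => // q _; exact: face2_continuous.
move=> a b /set_mem Ua /set_mem Ub ab; apply: composable_eq => //.
by apply: Uinj; rewrite ?inE // !composable_rng; congr r.
Qed.

Lemma face2_inj_loc p : exists U : set G2, [/\ open U, U p & set_inj U face2].
Proof.
have [U [oU Up Uinj]] := rng_inj_loc (face0 p).
exists (face0 @^-1` U); split=> //.
  by apply: open_comp => // q _; exact: face0_continuous.
move=> a b /set_mem Ua /set_mem Ub ab; apply: composable_eq => //.
by apply: Uinj; rewrite ?inE // -!composable_rng; congr s.
Qed.

Lemma face1_inj_loc p : exists U : set G2, [/\ open U, U p & set_inj U face1].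
Proof.
have [U [oU Up Uinj]] := rng_inj_loc (face2 p).
exists (face2 @^-1` U); split=> //.
  by apply: open_comp => // q _; exact: face2_continuous.
move=> a b /set_mem Ua /set_mem Ub ab.
have e2 : face2 a = face2 b.
  apply: Uinj; rewrite ?inE // -(rng_gmul (composable_rng a)).
  by rewrite -[gmul _ _]/(face1 a) ab /face1 rng_gmul //; exact: composable_rng.
apply: composable_eq => //.
have mulK (q : G2) : gmul (ginv (face2 q)) (face1 q) = face0 q.
  rewrite gmulA ?src_ginv //; last exact: composable_rng.
  by rewrite gmulVg composable_rng gmul_rng.
by rewrite -!mulK e2 ab.
Qed.

Lemma boundary1B (f g : Cc G) : boundary1 (f - g) = boundary1 f - boundary1 g.
Proof.
have hX := @unit_space_hausdorff G.
rewrite /boundary1 (pushforwardB src_inj_loc (@src_continuous G) hX).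
rewrite (pushforwardB rng_inj_loc (@rng_continuous G) hX).
by apply/funext => x; rewrite !fctE; ring.
Qed.

Lemma boundary2B (f g : Cc G2) : boundary2 (f - g) = boundary2 f - boundary2 g.
Proof.
have hG := @arrow_hausdorff G.
rewrite /boundary2 (pushforwardB face0_inj_loc face0_continuous hG).
rewrite (pushforwardB face1_inj_loc face1_continuous hG).
rewrite (pushforwardB face2_inj_loc face2_continuous hG).
by apply/funext => x; rewrite !fctE; ring.
Qed.

(** The boundary of a function in [Cc] is again in [Cc], so the elements of
    [Cc] (resp. cycles) of the form [boundary f] are all the boundaries. *)
Definition B0_pred : {pred Cc X} :=
  fun b => `[< exists f : Cc G, boundary1 f = b >].

Lemma B0_zmod_closed : zmod_closed B0_pred.
Proof.
split=> [|a b]; rewrite ?unfold_in.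
  by apply/asboolP; exists 0; rewrite -[0 in LHS](subrr 0) boundary1B subrr.
move=> /asboolP[f fa] /asboolP[g gb]; apply/asboolP; exists (f - g).
by rewrite boundary1B fa gb.
Qed.

HB.instance Definition _ := GRing.isZmodClosed.Build _ B0_pred B0_zmod_closed.

Definition H0 := Quotient.quot B0_pred.
HB.instance Definition _ := GRing.Zmodule.on H0.

Definition class0 (f : Cc X) : H0 := \pi_(Quotient.quot B0_pred) f.

Definition Z1_pred : {pred Cc G} := fun f => boundary1 f == 0.

Lemma Z1_zmod_closed : zmod_closed Z1_pred.
Proof.
split=> [|f g]; rewrite !unfold_in.
  by apply/eqP; rewrite -[0 in LHS](subrr 0) boundary1B subrr.
by rewrite boundary1B => /eqP-> /eqP->; rewrite subrr.
Qed.

HB.instance Definition _ := GRing.isZmodClosed.Build _ Z1_pred Z1_zmod_closed.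

Record Z1 := MkZ1 { Z1_Cc :> Cc G; _ : Z1_Cc \in Z1_pred }.

HB.instance Definition _ := [isSub for Z1_Cc].
HB.instance Definition _ := [Choice of Z1 by <:].
HB.instance Definition _ := [SubChoice_isSubZmodule of Z1 by <:].

Definition B1_pred : {pred Z1} :=
  fun z => `[< exists f : Cc G2, boundary2 f = z >].

Lemma B1_zmod_closed : zmod_closed B1_pred.
Proof.
split=> [|a b]; rewrite ?unfold_in.
  by apply/asboolP; exists 0; rewrite -[0 in LHS](subrr 0) boundary2B subrr.
move=> /asboolP[f fa] /asboolP[g gb]; apply/asboolP; exists (f - g).
by rewrite boundary2B fa gb.
Qed.

HB.instance Definition _ := GRing.isZmodClosed.Build _ B1_pred B1_zmod_closed.

Definition H1 := Quotient.quot B1_pred.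
HB.instance Definition _ := GRing.Zmodule.on H1.

Definition class1 (z : Z1) : H1 := \pi_(Quotient.quot B1_pred) z.

Lemma pushforward_indic (p : G -> X) (U : set G) :
  p @` U = setT -> set_inj U p ->
  pushforward p (fun g => (g \in U)%:Z) = fun=> 1.
Proof.
move=> pU pinj; apply/funext => x; rewrite /pushforward.
have : (p @` U) x by rewrite pU.
move=> [g Ug gx]; rewrite -(fsbig_widen [set g]) => [|_ -> //|h [/= hx gh]].
  by rewrite fsbig_set1 mem_set.
rewrite memNset // => Uh; apply: gh => /=.
by apply: pinj; rewrite ?inE // hx.
Qed.

Lemma full_bisection_compact (U : set G) : full_bisection U -> compact U.
Proof. by case=> -[]. Qed.

Lemma full_bisection_open (U : set G) : full_bisection U -> open U.
Proof. by case=> -[]. Qed.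

Definition bisection_Cc (U : set G) (fU : full_bisection U) : Cc G :=
  indic (@arrow_hausdorff G) (full_bisection_compact fU) (full_bisection_open fU).

Lemma bisection_Z1 (U : set G) (fU : full_bisection U) : bisection_Cc fU \in Z1_pred.
Proof.
case: (fU) => [[kU oU [ri si]] sU rU]; rewrite unfold_in.
by apply/eqP; rewrite /boundary1 /= !pushforward_indic // subrr.
Qed.

Definition bisection_cycle (U : set G) (fU : full_bisection U) : Z1 :=
  MkZ1 (bisection_Z1 fU).

End Homology.

Arguments H0 : clear implicits.
Arguments H1 : clear implicits.

Section Index.
Variable G : cantor_groupoid.
Implicit Types f t : full_group G.

Lemma full_group_bisection f :
  exists U : set G, full_bisection U /\ theta_of U (\val f).
Proof. by have [_ [U fU Uf]] := set_valP f; exists U. Qed.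

(** [I(theta(U)) = [1_U]]; see [full_index_theta]. *)
Definition full_index f : H1 G :=
  let: exist U UP := cid (full_group_bisection f) in
  class1 (bisection_cycle UP.1).

Lemma full_index_theta (U : set G) (fU : full_bisection U) f :
  theta_of U (\val f) -> full_index f = class1 (bisection_cycle fU).
Proof.
move=> Uf; rewrite /full_index; case: cid => V [fV Vf] /=.
have e := theta_unique fV fU Vf Uf; case: _ / e fU Uf => fU _.
by congr (class1 (bisection_cycle _)); exact: Prop_irrelevance.
Qed.

Definition full_group0 : set (full_group G) := [set f | full_index f = 0].

Definition transposition t :=
  (t * t = 1)%g /\ clopen [set x | \val t x = x].

Definition property_TR := full_group0 = group_generated transposition.

(** The choice of G-sets [U_1, ..., U_n] and of the elements [t_i = tau_(U_i)]
    from which [j([f] (x) 1)] is computed. *)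
Definition tau_choice (f : Cc (unit_space G)) n (U : 'I_n -> set G)
    (t : 'I_n -> full_group G) :=
  [/\ forall i, [/\ compact_open_bisection (U i),
        (@src G @` U i) `&` (@rng G @` U i) = set0 & is_tau (U i) (t i)],
      trivIset setT (fun i => @src G @` U i) &
      \bigcup_i (@src G @` U i) = [set x | odd `|f x|%N]].

End Index.

Definition exact_at (A B C : zmodType) (f : A -> B) (g : B -> C) :=
  range f = [set b | g b = 0].

(* Main.v *)
(** Write [G0] for the unit space. Two elements [tau_U], [tau_U'] with the same
    source are conjugate, by [tau_V] with [V = U' U^-1], when [s(U)], [r(U)] and
    [r(U')] are disjoint. Pure infiniteness and minimality embed any clopen set
    into any nonempty one by a compact open G-set, so that the disjointness can
    always be arranged after cutting [s(U)] into two pieces. Hence the class of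
    [tau_U] in the abelianization depends only on [s(U)]; it extends to a
    finitely additive measure [mu] on the clopen subsets of [G0], with values of
    order 2, such that [mu (s(U)) = mu (r(U))] for all compact open G-sets [U].
    Then [f |-> mu {f odd}] is additive and kills boundaries, which gives [j].

    The index of [tau_U] is [[U] + [U^-1] = 0], and every transposition is some
    [tau_U], so that property TR gives exactness at the abelianization.

    For the surjectivity of [I], write a cycle as [sum_i [U_i]] modulo
    boundaries. Each point lies in as many [s(U_i)] as [r(U_i)]; moving the [U_i]
    along copies [V_i] of [G0] with disjoint ranges, and matching ranges with
    sources by a locally constant permutation of the indices, turns their
    disjoint union into a single G-set with equal source and range. *)

Require Import Defs.
From HB Require Import structures.
From mathcomp Require Import all_boot all_order all_algebra perm freeg zify.
From mathcomp Require Import all_classical reals topology_theory.topology.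

Set Implicit Arguments.
Unset Strict Implicit.
Unset Printing Implicit Defensive.

Import GRing.Theory.

Local Open Scope classical_set_scope.
Local Open Scope quotient_scope.
Local Open Scope ring_scope.

(** * Maps out of quotients and tensor products *)

Section QuotientLift.
Variables (V W : zmodType) (S : zmodClosed V) (f : {additive V -> W}).

Lemma quot_lift : (forall v, v \in S -> f v = 0) ->
  exists g : {additive Quotient.quot S -> W},
    forall v, g (\pi_(Quotient.quot S) v) = f v.
Proof.
move=> f0; pose g (q : Quotient.quot S) := f (repr q).
have gE v : g (\pi_(Quotient.quot S) v) = f v.
  apply/eqP; rewrite -subr_eq0 -raddfB; apply/eqP/f0.
  by rewrite Quotient.idealrBE reprK.
have gB : zmod_morphism g.
  move=> a b; rewrite -[a]reprK -[b]reprK -raddfB !gE; exact: raddfB.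
by exists (HB.pack_for {additive Quotient.quot S -> W} g
  (GRing.isZmodMorphism.Build _ _ g gB)).
Qed.

End QuotientLift.

Section TensorLift.
Variables A B : zmodType.

(** The pure tensors generate: a representative in the free group is an integral combination of
    pairs. *)
Lemma tens_ind (W : zmodType) (phi : {additive tensor A B -> W}) :
  (forall a b, phi (tens a b) = 0) -> forall x, phi x = 0.
Proof.
move=> phi0 x; rewrite -[x]reprK -[repr x]freeg_sumE.
rewrite !raddf_sum big1 // => -[a b] _.
have -> : << coeff (a, b) (repr x) *g (a, b) >> =
    << (a, b) >> *~ coeff (a, b) (repr x) :> {freeg (A * B) / int}.
  by rewrite freeg_mulz intz.
by rewrite !raddfMz [X in X *~ _]phi0 mul0rz.
Qed.

(** The universal property: the extension of [beta] to the free group kills the bilinearity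
    relations. *)
Lemma tens_lift (W : zmodType) (beta : A -> B -> W) :
  (forall a a' b, beta (a + a') b = beta a b + beta a' b) ->
  (forall a b b', beta a (b + b') = beta a b + beta a b') ->
  exists phi : {additive tensor A B -> W}, forall a b, phi (tens a b) = beta a b.
Proof.
move=> bl br.
pose f (z : A * B) : zmodule W := beta z.1 z.2.
pose L : {freeg (A * B) / int} -> W := fglift f.
have LB : zmod_morphism L by move=> x y; exact: (lift_is_additive f x y).
pose La : {additive {freeg (A * B) / int} -> W} :=
  HB.pack L (GRing.isZmodMorphism.Build _ _ L LB).
have LU a b : La << (a, b) >> = beta a b.
  by rewrite /= /L liftU scale1r.
have [|phi phiE] :=
  quot_lift (f := La) (S := zmod_generated (@bilinear_relations A B)).
  (* Membership in the generated subgroup is tested on the kernel of [La]. *)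
  move=> v; rewrite unfold_in => /asboolP/(_ [set v | La v = 0]); apply.
  split; first split.
  - exact: raddf0.
  - move=> x y Lx Ly; suff : La (x - y) = 0 by [].
    by rewrite (raddfB La) [La x]Lx [La y]Ly subr0.
  - move=> w relw; suff : La w = 0 by [].
    case: relw => -[a [b [c ->]]]; rewrite !(raddfB La) !LU ?bl ?br.
      by rewrite addrAC addrK subrr.
    by rewrite addrAC addrK subrr.
by exists phi => a b; rewrite /tens [LHS]phiE LU.
Qed.

End TensorLift.

(** * Classes in the abelianization and maps out of it *)

Section Abel.
Variable Gam : groupType.

Lemma abel1 : abel (1 : Gam)%g = 0.
Proof. by apply: (addrI (abel 1%g)); rewrite -abelM mulg1 addr0. Qed.

(** Conjugate elements have the same class; conjugacy is written without inverses. *)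
Lemma abel_conj (v t t' : Gam) : (v * t = t' * v)%g -> abel t = abel t'.
Proof. by move/(congr1 (@abel _)); rewrite !abelM addrC => /addIr. Qed.

Lemma abelV (x : Gam) : abel x^-1%g = - abel x.
Proof. by apply/eqP; rewrite -addr_eq0 -abelM mulVg abel1. Qed.

End Abel.

Section AbelLift.
Variables (Gam : groupType) (W : zmodType) (phi : Gam -> W).
Hypothesis phiM : forall x y, phi (x * y)%g = phi x + phi y.

Lemma abel_surj (a : abelianization Gam) : exists x, a = abel x.
Proof. by exists (repr a); rewrite /abel reprK. Qed.

(** The kernel of [phi] is a subgroup containing all commutators, hence the derived subgroup, so
    [phi] is constant on classes. *)
Lemma abel_lift : exists I : {additive abelianization Gam -> W},
  forall x, I (abel x) = phi x.
Proof.
have phi1 : phi 1%g = 0 by apply: (addrI (phi 1%g)); rewrite -phiM mulg1 addr0.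
have phiV x : phi x^-1%g = - phi x by apply/eqP; rewrite -addr_eq0 -phiM mulVg phi1.
have phiD x : derived_subgroup x -> phi x = 0.
  move/(_ [set x | phi x = 0]); apply; split; first split=> //=.
    by move=> a b /= a0 b0; rewrite phiM phiV a0 b0 subr0.
  move=> _ [a [b ->]] /=.
  by rewrite commgEl /conjg !phiM !phiV addrA -opprD addNr.
pose I (a : abelianization Gam) := phi (repr a).
have IE x : I (abel x) = phi x.
  have /ab_equivP/asboolP/phiD : \pi_(abelianization Gam) (repr (abel x)) = \pi x.
    by rewrite reprK.
  by rewrite phiM phiV addrC => /eqP; rewrite subr_eq0 => /eqP.
have IB : zmod_morphism I.
  move=> a b; have [x ->] := abel_surj a; have [y ->] := abel_surj b.
  by rewrite -abelV -abelM !IE phiM phiV.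
by exists (HB.pack_for {additive abelianization Gam -> W} I
  (GRing.isZmodMorphism.Build _ _ I IB)).
Qed.

End AbelLift.

(** * Compact open sets *)

Section CompactInduction.
Variable T : topologicalType.

(** If [P K] failed, the sets whose complement in [K] satisfies [P] would form a proper filter
    containing [K]. At a cluster point in [K], a neighbourhood satisfying [P] has its complement in
    the filter, a contradiction. *)
Lemma compact_local_ideal (K : set T) (P : set T -> Prop) :
  compact K -> P set0 ->
  (forall A B, A `<=` B -> P B -> P A) ->
  (forall A B, P A -> P B -> P (A `|` B)) ->
  (forall x, K x -> exists2 N, nbhs x N & P N) -> P K.
Proof.
move=> cK P0 PS PU Pl; apply: contrapT => nPK.
pose F : set_system T := [set S | P (K `&` ~` S)].
have FF : ProperFilter F.
  split; first by rewrite /F /= setC0 setIT.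
  split; first by rewrite /F /= setCT setI0.
  - move=> A B FA FB; rewrite /F /= setCI setIUr; exact: PU.
  - by move=> A B AB; apply: PS; apply: setIS; exact: subsetC.
have FK : F K by rewrite /F /= setICr.
have [x [Kx cx]] := cK F FF FK; have [N Nx PN] := Pl _ Kx.
have FN : F (~` N) by rewrite /F /= setCK; apply: PS PN; exact: subIsetr.
by have [y [nNy Ny]] := cx _ _ FN Nx.
Qed.

Hypothesis hT : hausdorff_space T.

(** Here [P] need not pass to arbitrary subsets, as [compact_local_ideal] requires. So [Q] asks for
    a compact open [D] containing the set, all of whose compact open subsets have [P]. *)
Lemma compact_open_ind (P : set T -> Prop) :
  P set0 ->
  (forall A B, compact A -> open A -> compact B -> open B ->
    A `&` B = set0 -> P A -> P B -> P (A `|` B)) ->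
  forall K, compact K -> open K ->
  (forall x, K x -> exists D, [/\ compact D, open D, D x &
    forall C, compact C -> open C -> C `<=` D -> P C]) -> P K.
Proof.
move=> P0 PU K cK oK Pl.
pose Q (A : set T) := exists D, [/\ compact D, open D, A `<=` D &
  forall C, compact C -> open C -> C `<=` D -> P C].
suff [D [_ _ KD]] : Q K by apply.
apply: compact_local_ideal cK _ _ _ _.
- exists set0; split=> //; first exact: compact0.
    exact: open0.
  by move=> C _ _; rewrite subset0 => ->.
- by move=> A B AB [D [? ? BD ?]]; exists D; split=> //; exact: subset_trans BD.
- move=> A B [D [cD oD AD PD]] [E [cE oE BE PE]]; exists (D `|` E); split.
  + exact: compactU.
  + exact: openU.
  + exact: setUSS.
  + move=> C cC oC CDE; rewrite -(setUIDK C D).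
    have clD := compact_closed hT cD.
    have cC1 : compact (C `&` D) by apply: compact_closedI.
    have oC1 : open (C `&` D) by apply: openI.
    have oC2 : open (C `\` D).
      by rewrite setDE; apply: openI => //; exact: closed_openC.
    have cC2 : compact (C `\` D).
      by rewrite setDE; apply: compact_closedI => //; exact: open_closedC.
    apply: PU => //.
    * by rewrite -subset0 => x [[_ Dx] [_]].
    * by apply: PD => // z [].
    * by apply: PE => // x [/CDE[]].
- move=> x Kx; have [D [cD oD Dx PD]] := Pl _ Kx.
  by exists D; [apply: open_nbhs_nbhs | exists D; split].
Qed.

(** The quasi-component [Q] of [x] is shown to be connected: if open disjoint
    sets separate it, they already cover a clopen neighbourhood of [x]. *)
Lemma compact_totally_disconnected_clopen :
  compact [set: T] -> totally_disconnected [set: T] -> zero_dimensional T.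
Proof.
move=> cT tdT x y xy; apply: contrapT => nU.
pose Q : set T := [set z | forall C, clopen C -> C x -> C z].
have clQ : closed Q.
  have -> : Q = \bigcap_(C in [set C : set T | clopen C /\ C x]) C.
    by apply/seteqP; split=> z Qz C => [[cC Cx]|cC Cx]; apply: Qz.
  by apply: closed_bigI => C [[]].
have Qx : Q x by [].
have Qy : Q y.
  by move=> C cC Cx; apply: contrapT => nCy; apply: nU; exists C.
suff cQ : connected Q.
  have : connected_component setT x y by exists Q.
  by rewrite tdT //= => yx; move/eqP: xy; apply.
have sepQ (O O' : set T) z : open O -> open O' -> O `&` O' = set0 ->
    Q `<=` O `|` O' -> O x -> Q z -> O' z -> False.
  move=> oO oO' OO' QO Ox Qz O'z.
  (* Each point outside [O] and [O'] is outside [Q], so some clopen set around [x] misses it; by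
     compactness one clopen [C] around [x] misses them all. *)
  have [C [[oC cC] Cx CO]] : exists C : set T, [/\ clopen C, C x &
      C `&` ~` (O `|` O') = set0].
    apply: (@compact_local_ideal (~` (O `|` O'))
      (fun A => exists C : set T, [/\ clopen C, C x & C `&` A = set0])).
    - by apply: subclosed_compact cT _ => //; apply: open_closedC; apply: openU.
    - by exists setT; split=> //; [exact: clopenT | rewrite setI0].
    - move=> A B AB [C [cC Cx CB]]; exists C; split=> //.
      by rewrite -subset0 -CB; apply: setIS.
    - move=> A B [C [cC Cx CA]] [D [cD Dx DB]]; exists (C `&` D); split=> //.
        exact: clopenI.
      by rewrite setIUr setIAC CA set0I set0U -setIA DB setI0.
    - move=> u /= nOu; have : ~ Q u by move/QO.
      move=> /existsNP[C /not_implyP[cC /not_implyP[Cx nCu]]].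
      exists (~` C); last by exists C; split=> //; rewrite setICr.
      by apply: open_nbhs_nbhs; split=> //; apply: closed_openC; case: cC.
  have CE : C `&` O = C `&` ~` O'.
    apply/seteqP; split=> u [Cu Ou]; split=> //.
      by move=> O'u; suff : set0 u by []; rewrite -OO'.
    apply: contrapT => nOu; suff : set0 u by []; rewrite -CO; split=> //.
    by case.
  have clC : clopen (C `&` O).
    split; first exact: openI.
    by rewrite CE; apply: closedI => //; exact: open_closedC.
  have [_ Oz] := Qz _ clC (conj Cx Ox).
  by suff : set0 z by []; rewrite -OO'.
move=> B [b Bb] [C1 oC1 BE1] [C2 cC2 BE2].
apply: contrapT => nBQ.
have [b' [Qb' nBb']] : exists b', Q b' /\ ~ B b'.
  apply: contrapT => nb; apply: nBQ; apply/seteqP; split.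
    by rewrite BE1; exact: subIsetl.
  by move=> u Qu; apply: contrapT => nBu; apply: nb; exists u.
have clB : closed B by rewrite BE2; exact: closedI.
have clB' : closed (Q `&` ~` C1) by apply: closedI => //; exact: open_closedC.
have nB : set_nbhs B (~` (Q `&` ~` C1)).
  apply/set_nbhsP; exists (~` (Q `&` ~` C1)); split=> //.
    exact: closed_openC.
  by move=> u; rewrite BE1 => -[Qu C1u] [].
(* Normality separates [B] from the rest of [Q] by the disjoint open sets [O] and the complement of
   [closure N]. *)
have [N /set_nbhsP[O [oO BO ON]] NB'] := compact_normal hT cT clB nB.
have oO' := closed_openC (@closed_closure _ N).
have OO' : O `&` ~` closure N = set0.
  by rewrite -subset0 => u [/ON/subset_closure].
have QO : Q `<=` O `|` ~` closure N.
  move=> u Qu; have [C1u|nC1u] := pselect (C1 u).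
    by left; apply: BO; rewrite BE1.
  by right=> /NB'; apply.
have O'b' : (~` closure N) b'.
  by case: (QO _ Qb') => // Ob' /NB'; apply; split=> // C1b'; apply: nBb'; rewrite BE1.
have Qb : Q b by move: Bb; rewrite BE1 => -[].
have [Ox|O'x] := QO _ Qx; first exact: (sepQ _ _ _ oO oO' OO' QO Ox Qb' O'b').
apply: (sepQ _ _ b oO' oO) => //; first by rewrite setIC.
  by rewrite setUC.
exact: BO.
Qed.
End CompactInduction.

(** * Indicators of compact open sets *)

Section Characteristic.
Variables (T : topologicalType) (hT : hausdorff_space T).
Implicit Types (A B : set T) (f : Cc T).

(** Junk value [0] when [A] is not compact and open. *)
Definition chi A : Cc T :=
  if pselect (compact A /\ open A) is left AP then indic hT AP.1 AP.2 else 0.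

Lemma CcP_eq (f g : Cc T) : f =1 g -> f = g.
Proof. by move=> fg; apply: val_inj; apply/funext. Qed.

Lemma CcD (f g : Cc T) x : (f + g) x = f x + g x. Proof. by []. Qed.
Lemma CcN (f : Cc T) x : (- f) x = - f x. Proof. by []. Qed.

Lemma chiE A x : compact A -> open A -> chi A x = (x \in A)%:Z.
Proof. by move=> kA oA; rewrite /chi; case: pselect => // -[]. Qed.

Lemma chi0 : chi set0 = 0.
Proof.
apply: CcP_eq => x; rewrite chiE; [|exact: compact0|exact: open0].
by rewrite in_set0.
Qed.

Lemma chiU A B : compact A -> open A -> compact B -> open B -> A `&` B = set0 ->
  chi (A `|` B) = chi A + chi B.
Proof.
move=> kA oA kB oB AB; apply: CcP_eq => x; rewrite CcD.
rewrite !chiE //; [|exact: compactU|exact: openU].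
rewrite in_setU; have [Ax|nAx] := boolP (x \in A); last by rewrite add0r.
rewrite memNset ?addr0 // => Bx; suff : set0 x by [].
by rewrite -AB; split=> //; rewrite inE in Ax.
Qed.

Lemma pushforward_chi (Y : topologicalType) (p : T -> Y) A :
  set_inj A p -> compact A -> open A ->
  pushforward p (chi A) = fun y => (y \in p @` A)%:Z.
Proof.
move=> pi kA oA; apply/funext => y; rewrite /pushforward.
have [[x Ax xy]|nAy] := pselect ((p @` A) y).
  rewrite (mem_set (_ : (p @` A) y)); last by exists x.
  rewrite -(fsbig_widen [set x]) => [|_ -> //|z [/= pz zx]].
    by rewrite fsbig_set1 chiE // mem_set.
  rewrite chiE // memNset // => Az; apply: zx => /=.
  by apply: pi; rewrite ?inE // pz.
rewrite memNset // fsbig1 // => z pz; rewrite chiE // memNset // => Az.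
by apply: nAy; exists z.
Qed.

End Characteristic.

(** * Compact open G-sets *)

Section Bisections.
Variable G : cantor_groupoid.
Local Notation X := (unit_space G).
Local Notation s := (@src G).
Local Notation r := (@rng G).
Local Notation mul := (@gmul G).
Local Notation inv := (@ginv G).
Local Notation cob := (@compact_open_bisection G).
Implicit Types (g h k : G) (x y : X) (U V W : set G) (A B C : set X).

Lemma clopen_compact A : clopen A -> compact A.
Proof. by move=> [_ cA]; apply: subclosed_compact (@unit_space_compact G) _. Qed.

Lemma unit_zero_dimensional : zero_dimensional X.
Proof.
apply: compact_totally_disconnected_clopen; first exact: unit_space_hausdorff.
  exact: unit_space_compact.
by case: (cantor_units G).
Qed.

Lemma unit_clopen_nbhs x (N : set X) :
  nbhs x N -> exists D, [/\ clopen D, D x & D `<=` N].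
Proof.
move=> Nx; have [D [Dx cD] DN] := zero_dimensional_cvg
  (@unit_space_hausdorff G) unit_zero_dimensional (@unit_space_compact G) Nx.
by exists D.
Qed.

Lemma cob_src_clopen U : cob U -> clopen (s @` U).
Proof.
move=> [kU oU _]; split; first exact: src_open.
apply: compact_closed; first exact: unit_space_hausdorff.
by apply: continuous_compact => //; apply: continuous_subspaceT; exact: src_continuous.
Qed.

Lemma cob_rng_clopen U : cob U -> clopen (r @` U).
Proof.
move=> [kU oU _]; split; first exact: rng_open.
apply: compact_closed; first exact: unit_space_hausdorff.
by apply: continuous_compact => //; apply: continuous_subspaceT; exact: rng_continuous.
Qed.

Lemma cob_rng_inj U g h : cob U -> U g -> U h -> r g = r h -> g = h.
Proof. by move=> [_ _ [ri _]] Ug Uh; apply: ri; rewrite inE. Qed.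

Lemma cob_src_inj U g h : cob U -> U g -> U h -> s g = s h -> g = h.
Proof. by move=> [_ _ [_ si]] Ug Uh; apply: si; rewrite inE. Qed.

Lemma cobI U : compact U -> open U ->
  (forall g h, U g -> U h -> r g = r h -> g = h) ->
  (forall g h, U g -> U h -> s g = s h -> g = h) -> cob U.
Proof.
by move=> kU oU ri si; split=> //; split=> g h /set_mem Ug /set_mem Uh; auto.
Qed.

Lemma cob_subset U V : cob U -> compact V -> open V -> V `<=` U -> cob V.
Proof.
move=> cU kV oV VU; apply: cobI => // g h /VU Ug /VU Uh.
  exact: cob_rng_inj cU _ _.
exact: cob_src_inj cU _ _.
Qed.

Lemma cob_clopenI U (N : set G) : cob U -> clopen N -> cob (U `&` N).
Proof.
move=> cU [oN cN]; have [kU oU _] := cU.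
apply: cob_subset cU _ _ _; [exact: compact_closedI | exact: openI | exact: subIsetl].
Qed.

Lemma src_clopen A : clopen A -> clopen (s @^-1` A).
Proof. by move=> cA; apply: preimage_clopen cA _; exact: src_continuous. Qed.

Lemma rng_clopen A : clopen A -> clopen (r @^-1` A).
Proof. by move=> cA; apply: preimage_clopen cA _; exact: rng_continuous. Qed.

Lemma cob_srcI U A : cob U -> clopen A -> cob (U `&` s @^-1` A).
Proof. by move=> cU cA; apply: cob_clopenI => //; exact: src_clopen. Qed.

Lemma cob_rngI U A : cob U -> clopen A -> cob (U `&` r @^-1` A).
Proof. by move=> cU cA; apply: cob_clopenI => //; exact: rng_clopen. Qed.

Lemma src_srcI U A : s @` (U `&` s @^-1` A) = s @` U `&` A.
Proof.
apply/seteqP; split=> [_ [g [Ug Ag] <-]|_ [[g Ug <-] Ag]]; first by split=> //; exists g.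
by exists g.
Qed.

Lemma cob0 : cob set0.
Proof. by apply: cobI => //; [exact: compact0 | exact: open0]. Qed.

Lemma cobU U V : cob U -> cob V -> s @` U `&` s @` V = set0 ->
  r @` U `&` r @` V = set0 -> cob (U `|` V).
Proof.
move=> cU cV sUV rUV; have [kU oU _] := cU; have [kV oV _] := cV.
have sN g h : U g -> V h -> s g <> s h.
  move=> Ug Vh gh; suff : set0 (s g) by [].
  by rewrite -sUV; split; [exists g | exists h].
have rN g h : U g -> V h -> r g <> r h.
  move=> Ug Vh gh; suff : set0 (r g) by [].
  by rewrite -rUV; split; [exists g | exists h].
apply: cobI; [exact: compactU | exact: openU | |].
  move=> g h [Ug|Vg] [Uh|Vh] gh.
  + exact: (cob_rng_inj cU Ug Uh).
  + by case: (rN _ _ Ug Vh).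
  + by case: (rN _ _ Uh Vg).
  + exact: (cob_rng_inj cV Vg Vh).
move=> g h [Ug|Vg] [Uh|Vh] gh.
+ exact: (cob_src_inj cU Ug Uh).
+ by case: (sN _ _ Ug Vh).
+ by case: (sN _ _ Uh Vg).
+ exact: (cob_src_inj cV Vg Vh).
Qed.

Definition units_on A : set G := \val @` A.

Lemma units_onE A : units_on A = units G `&` r @^-1` A.
Proof.
apply/seteqP; split=> [_ [x Ax <-]|g [Gg Ag]].
  by split; [exact: units_val | rewrite /= rng_unit].
by exists (r g) => //; exact: unit_spaceP.
Qed.

Lemma src_units_on A : s @` units_on A = A.
Proof.
apply/seteqP; split=> [_ [_ [x Ax <-] <-]|x Ax]; first by rewrite src_unit.
by exists (\val x); [exists x | rewrite src_unit].
Qed.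

Lemma rng_units_on A : r @` units_on A = A.
Proof.
apply/seteqP; split=> [_ [_ [x Ax <-] <-]|x Ax]; first by rewrite rng_unit.
by exists (\val x); [exists x | rewrite rng_unit].
Qed.

Lemma cob_units_on A : clopen A -> cob (units_on A).
Proof.
move=> cA; rewrite units_onE; apply: cob_rngI => //.
by case: (full_bisection_units G).
Qed.

(** Adding the units off [p(U)] makes [p] bijective, so that the section
    becomes defined on all of the unit space. *)
Lemma bisection_section (p : G -> X) U :
  (forall V, open V -> open (p @` V)) -> continuous p ->
  (forall x, p (\val x) = x) -> open U -> set_inj U p -> closed (p @` U) ->
  exists sg : X -> G,
    [/\ continuous sg, cancel sg p & forall x, (p @` U) x -> U (sg x)].
Proof.
move=> po pc pv oU pi cU.
pose V := U `|` (units G `&` p @^-1` (~` (p @` U))).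
have oV : open V.
  apply: openU => //; apply: openI; first exact: units_open.
  by apply: open_comp => [g _|]; [exact: pc | exact: closed_openC].
have VE g : V g -> (p @` U) (p g) -> U g by move=> [|[_ nU /nU]].
have VN g : V g -> ~ (p @` U) (p g) -> \val (p g) = g.
  move=> [Ug|[Gg _]] nU; first by case: nU; exists g.
  by have := pv (exist _ g (mem_set Gg)); rewrite /= => ->.
have [||sg [csg Vsg sgK]] := open_section po oV.
- apply/seteqP; split=> // x _; have [[g Ug <-]|nx] := pselect ((p @` U) x).
    by exists g => //; left.
  by exists (\val x); [right; split; [exact: units_val | rewrite /= pv] | exact: pv].
- move=> g h /set_mem Vg /set_mem Vh gh.
  have [gU|ngU] := pselect ((p @` U) (p g)).
    by apply: pi => //; rewrite inE; apply: VE => //; rewrite -gh.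
  by rewrite -(VN _ Vg) // gh VN // -gh.
exists sg; split=> // x Ux; apply: VE => //; by rewrite sgK.
Qed.

Lemma src_section U : cob U -> exists sg : X -> G,
  [/\ continuous sg, cancel sg s & forall x, (s @` U) x -> U (sg x)].
Proof.
move=> cU; have [_ oU [_ si]] := cU; have [_ clU] := cob_src_clopen cU.
apply: bisection_section => //; first exact: src_open.
  exact: src_continuous.
exact: src_unit.
Qed.

Lemma rng_section U : cob U -> exists sg : X -> G,
  [/\ continuous sg, cancel sg r & forall x, (r @` U) x -> U (sg x)].
Proof.
move=> cU; have [_ oU [ri _]] := cU; have [_ clU] := cob_rng_clopen cU.
apply: bisection_section => //; first exact: rng_open.
  exact: rng_continuous.
exact: rng_unit.
Qed.

(** Cutting a small open G-set down to a clopen set [K] of ranges makes it compact: it is then the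
    image of [K] under a continuous section of the range map. *)
Lemma cob_basis g (N : set G) : nbhs g N -> exists D, [/\ cob D, D g & D `<=` N].
Proof.
rewrite nbhsE => -[O [oO Og] ON].
have [W1 [oW1 W1g i1]] := rng_inj_loc g; have [W2 [oW2 W2g i2]] := src_inj_loc g.
pose W := O `&` (W1 `&` W2).
have oW : open W by apply: openI => //; exact: openI.
have nW : nbhs (r g) (r @` W).
  by apply: open_nbhs_nbhs; split; [exact: rng_open | exists g].
have [K [[oK cK] Kg KW]] := unit_clopen_nbhs nW.
pose D := W `&` r @^-1` K.
have oD : open D.
  by apply: openI => //; apply: open_comp => // h _; exact: rng_continuous.
have ri a b : D a -> D b -> r a = r b -> a = b.
  by move=> [[_ [? _]] _] [[_ [? _]] _]; apply: i1; rewrite inE.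
have rD : r @` D = K.
  apply/seteqP; split=> [_ [h [_ Kh] <-] //|x Kx].
  by have [h Wh hx] := KW _ Kx; exists h => //; split; rewrite //= hx.
have rD' : set_inj D r by move=> a b /set_mem Da /set_mem Db; exact: ri.
have [sg [csg sgK Dsg]] := bisection_section (@rng_open G) (@rng_continuous G)
  (@rng_unit G) oD rD' (eq_ind_r closed cK rD).
exists D; split; last 2 first.
- by split.
- by move=> h [[Oh _] _]; exact: ON.
apply: cobI => //.
  have -> : D = sg @` K.
    apply/seteqP; split=> [h Dh|_ [x Kx <-]]; last by apply: Dsg; rewrite rD.
    have Kh : K (r h) by rewrite -rD; exists h.
    by exists (r h) => //; apply: ri => //; apply: Dsg; rewrite rD.
  apply: continuous_compact; last exact: clopen_compact.
  exact: continuous_subspaceT.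
by move=> a b [[_ [_ ?]] _] [[_ [_ ?]] _]; apply: i2; rewrite inE.
Qed.

Lemma cob_mul U V : cob U -> cob V -> cob (bisection_mul U V).
Proof.
move=> cU cV; have [kU oU _] := cU; have [kV oV _] := cV.
have [sg [csg sgK Usg]] := src_section cU.
have [rg [crg rgK Urg]] := rng_section cU.
have clsU := cob_src_clopen cU; have [orU _] := cob_rng_clopen cU.
apply: cobI.
(* Compactness: the product is a continuous image of a compact part of [V]. *)
- have -> : bisection_mul U V =
      (fun h => mul (sg (r h)) h) @` (V `&` r @^-1` (s @` U)).
    apply/seteqP; split=> [_ [g [h [Ug Vh gh ->]]]|_ [h [Vh Uh] <-]].
      exists h; first by split=> //; rewrite /= -gh; exists g.
      by rewrite -gh; congr mul; apply: (cob_src_inj cU) => //; apply: Usg; exists g.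
    by exists (sg (r h)), h; split=> //; exact: Usg.
  apply: continuous_compact; last by case: (cob_rngI cV clsU).
  apply: continuous_subspaceT; apply: gmul_comp_continuous.
  + by move=> h; apply: continuous_comp; [exact: rng_continuous | exact: csg].
  + by move=> h; apply: cvg_id.
  + by move=> h; rewrite sgK.
(* Openness: [k] lies in the product when its range lies in [r(U)] and what is left of [k], after
   cancelling the element of [U] with the same range, lies in [V]. *)
- have -> : bisection_mul U V =
      (r @^-1` (r @` U)) `&` (fun k => mul (inv (rg (r k))) k) @^-1` V.
    apply/seteqP; split=> [_ [g [h [Ug Vh gh ->]]]|k [/= Uk Vk]].
      rewrite /= rng_gmul //; split; first by exists g.
      have -> : rg (r g) = g by apply: (cob_rng_inj cU) => //; apply: Urg; exists g.
      by rewrite /= gmulA ?src_ginv // gmulVg gh gmul_rng.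
    exists (rg (r k)), (mul (inv (rg (r k))) k); split=> //; first exact: Urg.
      by rewrite rng_gmul ?rng_ginv // src_ginv rgK.
    by rewrite gmulA ?rng_ginv ?src_ginv ?rgK // gmulgV rgK gmul_rng.
  apply: openI; first by apply: open_comp => // h _; exact: rng_continuous.
  apply: open_comp => // k _; apply: gmul_comp_continuous.
  + move=> h; apply: continuous_comp; last exact: ginv_continuous.
    by apply: continuous_comp; [exact: rng_continuous | exact: crg].
  + by move=> h; apply: cvg_id.
  + by move=> h; rewrite src_ginv rgK.
- move=> _ _ [g [h [Ug Vh gh ->]]] [g' [h' [Ug' Vh' gh' ->]]].
  rewrite !rng_gmul // => rr; have e : g = g' by apply: (cob_rng_inj cU).
  by rewrite e; congr mul; apply: (cob_rng_inj cV) => //; rewrite -gh -gh' e.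
- move=> _ _ [g [h [Ug Vh gh ->]]] [g' [h' [Ug' Vh' gh' ->]]].
  rewrite !src_gmul // => ss; have e : h = h' by apply: (cob_src_inj cV).
  by rewrite e; congr (mul _ _); apply: (cob_src_inj cU) => //; rewrite gh gh' e.
Qed.

Lemma src_bisection_mul U V : r @` V `<=` s @` U -> s @` bisection_mul U V = s @` V.
Proof.
move=> VU; apply/seteqP; split=> [_ [_ [g [h [Ug Vh gh ->]]] <-]|_ [h Vh <-]].
  by rewrite src_gmul //; exists h.
have [g Ug gh] : (s @` U) (r h) by apply: VU; exists h.
by exists (mul g h); [exists g, h | rewrite src_gmul].
Qed.

Lemma rng_bisection_mul U V : s @` U `<=` r @` V -> r @` bisection_mul U V = r @` U.
Proof.
move=> UV; apply/seteqP; split=> [_ [_ [g [h [Ug Vh gh ->]]] <-]|_ [g Ug <-]].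
  by rewrite rng_gmul //; exists g.
have [h Vh gh] : (r @` V) (s g) by apply: UV; exists g.
by exists (mul g h); [exists g, h | rewrite rng_gmul].
Qed.

Lemma src_ginv_image U : s @` (inv @^-1` U) = r @` U.
Proof.
apply/seteqP; split=> [_ [g Ug <-]|_ [g Ug <-]].
  by exists (inv g) => //; rewrite rng_ginv.
by exists (inv g); rewrite /= ?ginvK // src_ginv.
Qed.

Lemma rng_ginv_image U : r @` (inv @^-1` U) = s @` U.
Proof.
apply/seteqP; split=> [_ [g Ug <-]|_ [g Ug <-]].
  by exists (inv g) => //; rewrite src_ginv.
by exists (inv g); rewrite /= ?ginvK // rng_ginv.
Qed.

End Bisections.

(** * One-chains modulo boundaries *)

Section ChainClasses.
Variable G : cantor_groupoid.
Local Notation X := (unit_space G).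
Local Notation G2 := (set_type (composable G)).
Local Notation s := (@src G).
Local Notation r := (@rng G).
Local Notation mul := (@gmul G).
Local Notation inv := (@ginv G).
Local Notation cob := (@compact_open_bisection G).
Implicit Types (g h k : G) (x y : X) (U V W : set G) (A B C : set X).

Definition ones U : Cc G := chi (@arrow_hausdorff G) U.

Definition B1chain_pred : {pred Cc G} :=
  fun b => `[< exists f : Cc G2, boundary2 f = b >].

Lemma B1chain_zmod_closed : zmod_closed B1chain_pred.
Proof.
split=> [|a b]; rewrite ?unfold_in.
  by apply/asboolP; exists 0; rewrite -[0 in LHS](subrr 0) boundary2B subrr.
move=> /asboolP[f fa] /asboolP[g gb]; apply/asboolP; exists (f - g).
by rewrite boundary2B fa gb.
Qed.

HB.instance Definition _ :=
  GRing.isZmodClosed.Build _ B1chain_pred B1chain_zmod_closed.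

(** All 1-chains modulo boundaries, where the indicator of any compact open
    G-set has a class, cycle or not. *)
Definition chain_quot := Quotient.quot B1chain_pred.
HB.instance Definition _ := GRing.Zmodule.on chain_quot.

Definition cls (f : Cc G) : chain_quot := \pi_(Quotient.quot B1chain_pred) f.

Lemma clsD (f g : Cc G) : cls (f + g) = cls f + cls g.
Proof. exact: raddfD. Qed.

Lemma clsN (f : Cc G) : cls (- f) = - cls f.
Proof. exact: raddfN. Qed.

Lemma cls0 : cls 0 = 0.
Proof. exact: raddf0. Qed.

Lemma cls_eq (f g : Cc G) : cls f = cls g <-> exists h : Cc G2, boundary2 h = f - g.
Proof.
split=> [/eqP|fg].
  by rewrite /cls -Quotient.idealrBE unfold_in => /asboolP.
by apply/eqP; rewrite /cls -Quotient.idealrBE unfold_in; apply/asboolP.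
Qed.

(** [H1 G] embeds in [chain_quot], so homology classes may be compared by way of pieces that are not
    cycles. *)
Lemma class1_eq (z z' : Z1 G) : class1 z = class1 z' <-> cls z = cls z'.
Proof.
rewrite cls_eq; split=> [/eqP|zz'].
  by rewrite /class1 -Quotient.idealrBE unfold_in => /asboolP.
by apply/eqP; rewrite /class1 -Quotient.idealrBE unfold_in; apply/asboolP.
Qed.

Lemma class1D (z z' : Z1 G) : class1 (z + z') = class1 z + class1 z'.
Proof. exact: raddfD. Qed.

Lemma composable_hausdorff : hausdorff_space G2.
Proof.
move=> p q pq; apply: composable_eq; apply: (@arrow_hausdorff G) => A B nA nB.
  have [z [Az Bz]] := pq _ _ (face2_continuous nA) (face2_continuous nB).
  by exists (face2 z).
have [z [Az Bz]] := pq _ _ (face0_continuous nA) (face0_continuous nB).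
by exists (face0 z).
Qed.

(** The composable pairs with first entry in [U] and second in [V] form a compact open set on which
    the three faces are injective, with images [V], the product and [U]. Its indicator is the
    required 2-chain. *)
Lemma ones_mul_boundary U V : cob U -> cob V -> s @` U = r @` V ->
  exists h : Cc G2, boundary2 h = ones V - ones (bisection_mul U V) + ones U.
Proof.
move=> cU cV sUrV; have [kU oU _] := cU; have [kV oV _] := cV.
have [kM oM _] := cob_mul cU cV.
pose S : set G2 := [set p | U (face2 p) /\ V (face0 p)].
have [sg [csg sgK Usg]] := src_section cU.
have Sr (p : G2) : s (face2 p) = r (face0 p) by exact: composable_rng.
have oS : open S.
  apply: openI; apply: open_comp => // p _; first exact: face2_continuous.
  exact: face0_continuous.
pose psi h : G2 := exist _ (sg (r h), h)
  (mem_set (sgK (r h) : composable G (sg (r h), h))).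
have cpsi : continuous psi.
  apply: continuous_comp_initial => h; apply: cvg_pair; last exact: cvg_id.
  by apply: continuous_comp; [exact: rng_continuous | exact: csg].
have Spsi h : V h -> S (psi h).
  by move=> Vh; split=> //; apply: Usg; rewrite sUrV; exists h.
have kS : compact S.
  have -> : S = psi @` V; last first.
    by apply: continuous_compact => //; exact: continuous_subspaceT.
  apply/seteqP; split=> [p [Up Vp]|_ [h Vh <-]]; last exact: Spsi.
  exists (face0 p) => //; apply: composable_eq => //.
  have Up' : U (face2 (psi (face0 p))) by case: (Spsi _ Vp).
  by apply: (cob_src_inj cU Up' Up); rewrite /face2 /= sgK Sr.
have i0 : set_inj S (@face0 G).
  move=> p q /set_mem[Up Vp] /set_mem[Uq Vq] pq; apply: composable_eq => //.
  by apply: (cob_src_inj cU Up Uq); rewrite !Sr pq.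
have i2 : set_inj S (@face2 G).
  move=> p q /set_mem[Up Vp] /set_mem[Uq Vq] pq; apply: composable_eq => //.
  by apply: (cob_rng_inj cV Vp Vq); rewrite -!Sr pq.
have i1 : set_inj S (@face1 G).
  move=> p q Sp Sq pq; have [Up Vp] := set_mem Sp; have [Uq Vq] := set_mem Sq.
  apply: i0 => //; apply: (cob_src_inj cV Vp Vq).
  by have := congr1 s pq; rewrite /face1 !src_gmul //; exact: composable_rng.
exists (chi composable_hausdorff S); rewrite /boundary2 !pushforward_chi //.
have -> : @face0 G @` S = V.
  by apply/seteqP; split=> [_ [p [_ Vp] <-] //|h Vh]; exists (psi h) => //; exact: Spsi.
have -> : @face2 G @` S = U.
  apply/seteqP; split=> [_ [p [Up _] <-] //|g Ug].
  have [h Vh gh] : (r @` V) (s g) by rewrite -sUrV; exists g.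
  exists (psi h); first exact: Spsi.
  have [Up _] := Spsi _ Vh; apply: (cob_src_inj cU Up Ug).
  by rewrite Sr /face0 /= gh.
have -> : @face1 G @` S = bisection_mul U V.
  apply/seteqP; split=> [_ [p [Up Vp] <-]|_ [g [h [Ug Vh gh ->]]]].
    by exists (face2 p), (face0 p).
  exists (psi h); first exact: Spsi.
  rewrite /face1 /=; congr mul; have [Up _] := Spsi _ Vh.
  by apply: (cob_src_inj cU Up Ug); rewrite Sr /face0 /= gh.
by apply/funext => g; rewrite !fctE !CcD CcN !chiE.
Qed.

Lemma cls_mul U V : cob U -> cob V -> s @` U = r @` V ->
  cls (ones (bisection_mul U V)) = cls (ones U) + cls (ones V).
Proof.
move=> cU cV UV; rewrite -clsD; apply/esym/cls_eq.
have [h hE] := ones_mul_boundary cU cV UV; exists h; rewrite hE.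
by apply/funext => g; rewrite !(CcD, CcN) [LHS]addrC addrA.
Qed.

(** The units on [A] are idempotent under the product, so their class [c] satisfies [c = c + c]. *)
Lemma cls_units_on A : clopen A -> cls (ones (units_on A)) = 0.
Proof.
move=> cA; have cE := cob_units_on cA.
have := cls_mul cE cE; rewrite src_units_on rng_units_on => /(_ erefl).
have -> : bisection_mul (units_on A) (units_on A) = units_on A.
  apply/seteqP; split=> [_ [_ [_ [[x Ax <-] [y Ay <-] xy ->]]]|_ [x Ax <-]].
    rewrite src_unit rng_unit in xy; rewrite -xy; exists x => //.
    by have := gmul_src (\val x); rewrite src_unit.
  exists (\val x), (\val x); split; [by exists x| by exists x| |].
    by rewrite src_unit rng_unit.
  by have := gmul_src (\val x); rewrite src_unit.
by move/eqP; rewrite -subr_eq subrr => /eqP.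
Qed.

Lemma mul_ginv_set U : cob U -> bisection_mul U (inv @^-1` U) = units_on (r @` U).
Proof.
move=> cU; apply/seteqP; split=> [_ [g [h [Ug Uh gh ->]]]|_ [_ [g Ug <-] <-]].
  have -> : h = inv g.
    by rewrite -[h]ginvK; congr inv; apply: (cob_src_inj cU) => //; rewrite src_ginv.
  by rewrite gmulgV; exists (r g) => //; exists g.
by exists g, (inv g); split=> //=; rewrite ?ginvK ?rng_ginv ?gmulgV.
Qed.

(** The product of [U] with its inverse consists of units, whose class vanishes. *)
Lemma cls_inv U : cob U -> cls (ones (inv @^-1` U)) = - cls (ones U).
Proof.
move=> cU; have cV := bisection_inv cU.
have := cls_mul cU cV; rewrite rng_ginv_image => /(_ erefl).
rewrite mul_ginv_set // cls_units_on; last exact: cob_rng_clopen.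
by move/eqP; rewrite eq_sym addrC addr_eq0 => /eqP.
Qed.

Lemma cls_onesU U V : cob U -> cob V -> U `&` V = set0 ->
  cls (ones (U `|` V)) = cls (ones U) + cls (ones V).
Proof. by move=> [kU oU _] [kV oV _] UV; rewrite /ones chiU // clsD. Qed.

Lemma bisection_cycleE U (fU : full_bisection U) :
  (bisection_cycle fU : Cc G) = ones U.
Proof.
apply: CcP_eq => g; rewrite /ones chiE //; by case: (fU) => -[].
Qed.

(** Composition corresponds to the product of G-sets, and [cls_mul] applies since both have full
    source and range. *)
Lemma full_indexM (f f' : full_group G) :
  full_index (f * f')%g = full_index f + full_index f'.
Proof.
have [U [fU Uf]] := full_group_bisection f.
have [V [fV Vf]] := full_group_bisection f'.
rewrite (full_index_theta fU Uf) (full_index_theta fV Vf) -class1D.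
rewrite (full_index_theta (full_bisection_mul fU fV)); last exact: theta_comp.
apply/class1_eq; rewrite clsD.
rewrite -[X in cls X + _]/(Z1_Cc (bisection_cycle fU)).
rewrite -[X in _ + cls X]/(Z1_Cc (bisection_cycle fV)) !bisection_cycleE.
by case: fU fV => [cU sU rU] [cV sV rV]; apply: cls_mul; rewrite ?sU ?rV.
Qed.

End ChainClasses.

(** * Generation of the 1-chains by G-sets *)

Section CcGeneration.
Variable G : cantor_groupoid.
Local Notation cob := (@compact_open_bisection G).

Lemma CcMz (T : topologicalType) (f : Cc T) c x : (f *~ c) x = f x *~ c.
Proof.
have n_ n : (f *+ n) x = f x *+ n.
  by elim: n => // n IHn; rewrite !mulrS CcD IHn.
by case: c => n; rewrite ?NegzE ?mulrNz ?CcN -!pmulrn n_.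
Qed.

(** A function in [Cc G] is locally constant, so its support splits into compact open G-sets on
    which it is a multiple of an indicator. *)
Lemma Cc_ind (S : Cc G -> Prop) :
  S 0 -> (forall f f', S f -> S f' -> S (f - f')) ->
  (forall U, cob U -> S (ones U)) -> forall h, S h.
Proof.
move=> S0 SB S1 h.
have SN f : S f -> S (- f) by move=> Sf; rewrite -sub0r; exact: SB.
have SD f f' : S f -> S f' -> S (f + f').
  by move=> Sf Sf'; rewrite -[f']opprK; apply: SB => //; exact: SN.
have SM f c : S f -> S (f *~ c).
  move=> Sf; have n_ n : S (f *+ n).
    by elim: n => // n IHn; rewrite mulrS; exact: SD.
  by case: c => n; rewrite ?NegzE ?mulrNz -!pmulrn; [|apply: SN]; exact: n_.
have ch := (int_continuousP _).1 (@Cc_continuous _ h).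
pose K := [set g | h g != 0].
have oK : open K.
  rewrite openE => g Kg; apply: filterS (ch g) => g' /= e; by rewrite /K /= e.
have clK : closed K.
  rewrite -[K]setCK; apply: open_closedC; rewrite openE => g /negP/negPn/eqP Kg.
  by apply: filterS (ch g) => g' /= e; rewrite /K /= e Kg eqxx.
have kK : compact K by rewrite (closure_id K).1 //; exact: Cc_compact.
suff [f [Sf fK f0]] : exists f : Cc G,
    [/\ S f, forall g, K g -> f g = h g & forall g, ~ K g -> f g = 0].
  suff <- : f = h by [].
  apply: CcP_eq => g; have [Kg|nKg] := pselect (K g); first exact: fK.
  by rewrite f0 //; apply/esym/eqP; apply/negPn/negP.
apply: (@compact_open_ind _ (@arrow_hausdorff G) (fun K => exists f : Cc G,
    [/\ S f, forall g, K g -> f g = h g & forall g, ~ K g -> f g = 0])) => //.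
- by exists 0.
- move=> C D _ _ _ _ CD [f [Sf fC f0]] [f' [Sf' fD' f0']].
  exists (f + f'); split; first exact: SD.
    move=> g [Cg|Dg]; rewrite CcD.
      rewrite fC // f0' ?addr0 // => Dg; suff : set0 g by [].
      by rewrite -CD.
    rewrite fD' // f0 ?add0r // => Cg; suff : set0 g by [].
    by rewrite -CD.
  by move=> g nCD; rewrite CcD f0 ?f0' // => ?; apply: nCD; [right|left].
- move=> g _; have [D [cD Dg Dh]] := cob_basis (ch g).
  have [kD oD _] := cD; exists D; split=> // C kC oC CD.
  have cC := cob_subset cD kC oC CD.
  exists (ones C *~ h g); split; first by apply: SM; exact: S1.
    move=> g' Cg'; rewrite CcMz chiE // mem_set // mulrzz mul1r.
    by apply/esym; exact: (Dh _ (CD _ Cg')).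
  by move=> g' nC; rewrite CcMz chiE // memNset // mul0rz.
Qed.

End CcGeneration.

(** * The elements [tau_U] in the abelianization *)

Section Taus.
Variable G : cantor_groupoid.
Local Notation X := (unit_space G).
Local Notation s := (@src G).
Local Notation r := (@rng G).
Local Notation mul := (@gmul G).
Local Notation inv := (@ginv G).
Local Notation cob := (@compact_open_bisection G).
Implicit Types (g h k : G) (x y : X) (U V W : set G) (A B C : set X)
  (t v : full_group G).

(** Without isolated points [A] has two distinct points, and a clopen set separates them. *)
Lemma unit_clopen_split A : clopen A -> A !=set0 ->
  exists C, [/\ clopen C, (A `&` C) !=set0 & (A `&` ~` C) !=set0].
Proof.
move=> [oA cA] [x Ax].
have [y [Ay yx]] : exists y, A y /\ y <> x.
  apply: contrapT => ny; have : isolated [set: X] x.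
    split; first by rewrite inE.
    exists A; first exact: open_nbhs_nbhs.
    rewrite setIT; apply/seteqP; split=> [y Ay|_ -> //].
    by apply: contrapT => yx; apply: ny; exists y.
  by case: (cantor_units G) => _ _ _ ->.
have xy : x != y by apply/eqP => /esym.
have [C [cC Cx nCy]] := unit_zero_dimensional xy.
by exists C; split=> //; [exists x | exists y].
Qed.

Lemma clopen_avoid A x : clopen A -> A !=set0 ->
  exists C, [/\ clopen C, C `<=` A, C !=set0 & ~ C x].
Proof.
move=> cA A0; have [C [cC AC AnC]] := unit_clopen_split cA A0.
have [Cx|nCx] := pselect (C x).
  exists (A `&` ~` C); split=> //; last by case.
  by apply: clopenI => //; exact: clopenC.
by exists (A `&` C); split=> //; [exact: clopenI | case].
Qed.

(** The G-sets for which [tau_U] is defined. *)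
Definition free_cob U := cob U /\ s @` U `&` r @` U = set0.

Lemma free_neq U g h : free_cob U -> U g -> U h -> s g <> r h.
Proof.
move=> [_ U0] Ug Uh gh; suff : set0 (s g) by [].
by rewrite -U0; split; [exists g | exists h].
Qed.

Lemma free_sub U V : free_cob U -> cob V -> V `<=` U -> free_cob V.
Proof.
move=> [_ U0] cV VU; split=> //.
rewrite -subset0 => x [[g Vg gx] [h Vh hx]]; rewrite -U0.
by split; [exists g => //; exact: VU | exists h => //; exact: VU].
Qed.

Lemma tau_unique U t t' : is_tau U t -> is_tau U t' -> t = t'.
Proof.
move=> [ts tr tf] [ts' tr' tf']; apply: val_inj; apply/funext => x.
have [[g Ug <-]|nx] := pselect ((s @` U) x); first by rewrite ts ?ts'.
have [[g Ug <-]|nx'] := pselect ((r @` U) x); first by rewrite tr ?tr'.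
by rewrite tf ?tf'.
Qed.

Lemma tau_sq U t : is_tau U t -> (t * t = 1)%g.
Proof.
move=> [ts tr tf]; apply: val_inj; apply/funext => x; rewrite /=.
have [[g Ug <-]|nx] := pselect ((s @` U) x); first by rewrite ts ?tr.
have [[g Ug <-]|nx'] := pselect ((r @` U) x); first by rewrite tr ?ts.
by rewrite !tf.
Qed.

Lemma tau_inv U t : is_tau U t -> is_tau (inv @^-1` U) t.
Proof.
move=> [ts tr tf]; split=> [g Ug|g Ug|x].
- by rewrite -rng_ginv tr // src_ginv.
- by rewrite -src_ginv ts // rng_ginv.
- by rewrite src_ginv_image rng_ginv_image => ? ?; apply: tf.
Qed.

Lemma tauU U V t v : free_cob (U `|` V) -> U `&` V = set0 ->
  is_tau U t -> is_tau V v -> is_tau (U `|` V) (t * v)%g.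
Proof.
move=> fUV UV [ts tr tf] [vs vr vf].
have UVN g : U g -> V g -> False.
  by move=> Ug Vg; suff : set0 g by []; rewrite -UV.
have [cUV _] := fUV.
have sN g h : U g -> V h -> s g <> s h.
  move=> Ug Vh /(cob_src_inj cUV (or_introl Ug) (or_intror Vh)) gh.
  by apply: (UVN g) => //; rewrite gh.
have rN g h : U g -> V h -> r g <> r h.
  move=> Ug Vh /(cob_rng_inj cUV (or_introl Ug) (or_intror Vh)) gh.
  by apply: (UVN g) => //; rewrite gh.
have srN g h : U g -> V h -> s g <> r h.
  by move=> Ug Vh; apply: (free_neq fUV); [left | right].
have rsN g h : U g -> V h -> r g <> s h.
  by move=> Ug Vh /esym; apply: (free_neq fUV); [right | left].
split=> [g [Ug|Vg]|g [Ug|Vg]|x nsx nrx] /=.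
- rewrite vf ?ts //; move=> [h Vh /esym]; [exact: sN|exact: srN].
- rewrite vs // tf //; move=> [h Uh]; [exact: srN|exact: rN].
- rewrite vf ?tr //; move=> [h Vh /esym]; [exact: rsN|exact: rN].
- rewrite vr // tf //; move=> [h Uh]; [exact: sN|exact: rsN].
- rewrite vf ?tf // => -[h Uh hx].
  + by apply: nsx; exists h => //; left.
  + by apply: nrx; exists h => //; left.
  + by apply: nsx; exists h => //; right.
  + by apply: nrx; exists h => //; right.
Qed.

Lemma tau_split U A t : free_cob U -> clopen A -> is_tau U t ->
  exists t1 t2, [/\ is_tau (U `&` s @^-1` A) t1,
    is_tau (U `&` s @^-1` (~` A)) t2 & t = (t1 * t2)%g].
Proof.
move=> fU cA tU; have [cU _] := fU.
have f1 : free_cob (U `&` s @^-1` A).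
  by apply: free_sub fU _ _; [exact: cob_srcI | exact: subIsetl].
have f2 : free_cob (U `&` s @^-1` (~` A)).
  apply: free_sub fU _ _; last exact: subIsetl.
  by apply: cob_srcI => //; exact: clopenC.
have [t1 t1P] := tau_exists f1.1 f1.2; have [t2 t2P] := tau_exists f2.1 f2.2.
exists t1, t2; split=> //; apply: tau_unique tU _.
have UE : U = (U `&` s @^-1` A) `|` (U `&` s @^-1` (~` A)).
  by rewrite -setIUr -preimage_setU setUv preimage_setT setIT.
rewrite {1}UE; apply: tauU => //; first by rewrite -UE.
by rewrite setIACA -preimage_setI setICr preimage_set0 setI0.
Qed.

(** [tau_V] with [V = U' U^-1] conjugates [tau_U] into [tau_U']. *)
Lemma tau_conj U U' t t' : free_cob U -> free_cob U' -> s @` U = s @` U' ->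
  r @` U `&` r @` U' = set0 -> is_tau U t -> is_tau U' t' -> abel t = abel t'.
Proof.
move=> fU fU' ss rr [ts tr tf] [ts' tr' tf'].
have [cU U0] := fU; have [cU' U'0] := fU'.
pose V := bisection_mul U' (inv @^-1` U).
have cV : cob V by apply: cob_mul => //; exact: bisection_inv.
have sV : s @` V = r @` U.
  by rewrite src_bisection_mul ?src_ginv_image // rng_ginv_image ss.
have rV : r @` V = r @` U'.
  by rewrite rng_bisection_mul // rng_ginv_image ss.
have [|v [vs vr vf]] := @tau_exists G V cV; first by rewrite sV rV.
have VE g g' : U g -> U' g' -> s g = s g' -> V (mul g' (inv g)).
  by move=> Ug Ug' gg'; exists g', (inv g); split; rewrite //= ?ginvK // rng_ginv.
(* The homeomorphism [v] swaps [r(U)] and [r(U')] along the common sources and fixes [s(U)]. *)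
have v1 g g' : U g -> U' g' -> s g = s g' -> \val v (r g) = r g'.
  move=> Ug Ug' gg'; have Vg := VE _ _ Ug Ug' gg'.
  have e : s g' = r (inv g) by rewrite rng_ginv.
  by have := vs _ Vg; rewrite src_gmul // rng_gmul // src_ginv.
have v2 g g' : U g -> U' g' -> s g = s g' -> \val v (r g') = r g.
  move=> Ug Ug' gg'; have Vg := VE _ _ Ug Ug' gg'.
  have e : s g' = r (inv g) by rewrite rng_ginv.
  by have := vr _ Vg; rewrite src_gmul // rng_gmul // src_ginv.
have vsrc g : U g -> \val v (s g) = s g.
  move=> Ug; apply: vf; rewrite ?sV ?rV => -[h Uh /esym].
    exact: free_neq fU Ug Uh.
  have [g' Ug' <-] : (s @` U') (s g) by rewrite -ss; exists g.
  exact: free_neq fU' Ug' Uh.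
have UU' g : U g -> exists2 g', U' g' & s g = s g'.
  move=> Ug; have [g' ? ?] : (s @` U') (s g) by rewrite -ss; exists g.
  by exists g'.
have U'U g' : U' g' -> exists2 g, U g & s g = s g'.
  move=> Ug'; have [g ? ?] : (s @` U) (s g') by rewrite ss; exists g'.
  by exists g.
have rrN g g' : U g -> U' g' -> r g <> r g'.
  move=> Ug Ug' gg'; suff : set0 (r g) by [].
  by rewrite -rr; split; [exists g | exists g'].
apply: (abel_conj (v := v)); apply: val_inj; apply/funext => x /=.
have [[g Ug <-]|nsx] := pselect ((s @` U) x).
  have [g' Ug' gg'] := UU' _ Ug.
  by rewrite ts // (v1 _ g') // vsrc // gg' ts'.
have [[g Ug <-]|nrx] := pselect ((r @` U) x).
  have [g' Ug' gg'] := UU' _ Ug.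
  by rewrite tr // (v1 _ g') // vsrc // gg' tr'.
have [[g' Ug' g'x]|nrx'] := pselect ((r @` U') x); last first.
  by rewrite tf // vf ?sV ?rV // tf' // -ss.
have [g Ug gg'] := U'U _ Ug'.
rewrite tf // -g'x (v2 g) // tf' //.
  by rewrite -ss => -[h Uh]; exact: free_neq fU Uh Ug.
by move=> [h Uh /esym]; exact: rrN.
Qed.

Hypothesis Gmin : minimal_groupoid G.
Hypothesis Gpi : purely_infinite G.

(** Minimality gives an arrow from each point of [A] into [B], hence an embedding of a small
    neighbourhood. Two embeddings into [B] with disjoint sources are glued after composing them with
    the two G-sets from the proper infiniteness of [B], which makes their ranges disjoint. *)
Lemma clopen_embed A B : clopen A -> clopen B -> (A !=set0 -> B !=set0) ->
  exists U, [/\ cob U, s @` U = A & r @` U `<=` B].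
Proof.
move=> cA cB AB.
apply: (@compact_open_ind _ (@unit_space_hausdorff G)
  (fun A => exists U, [/\ cob U, s @` U = A & r @` U `<=` B]) _ _ A).
- by exists set0; rewrite !image_set0; split=> //; exact: cob0.
- move=> A1 A2 _ _ _ _ A12 [U1 [c1 s1 r1]] [U2 [c2 s2 r2]].
  have [V [W [cV cW [sV sW] VWB VW]]] := Gpi cB.
  have rl U V' : r @` bisection_mul V' U `<=` r @` V'.
    by move=> _ [_ [g [h [Vg Uh gh ->]]] <-]; rewrite rng_gmul //; exists g.
  have e1 : s @` bisection_mul V U1 = A1 by rewrite src_bisection_mul // sV.
  have e2 : s @` bisection_mul W U2 = A2 by rewrite src_bisection_mul // sW.
  exists (bisection_mul V U1 `|` bisection_mul W U2); split.
  + apply: cobU; [exact: cob_mul | exact: cob_mul | by rewrite e1 e2 |].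
    by rewrite -subset0 -VW; apply: setISS; exact: rl.
  + by rewrite image_setU e1 e2.
  + rewrite image_setU; apply: subset_trans VWB; apply: setUSS; exact: rl.
- exact: clopen_compact.
- by case: cA.
- move=> x Ax; have B0 : B !=set0 by apply: AB; exists x.
  have [y [By [g gx gy]]] := Gmin x B0 cB.1.
  have nB : nbhs g (r @^-1` B).
    apply: open_nbhs_nbhs; split; last by rewrite /= gy.
    by case: (rng_clopen cB).
  have [D [cD Dg DB]] := cob_basis nB.
  have cs := cob_src_clopen cD.
  exists (s @` D); split; [exact: clopen_compact | by case: cs | by exists g |].
  move=> C kC oC CD.
  have cC : clopen C.
    by split=> //; apply: compact_closed kC; exact: unit_space_hausdorff.
  exists (D `&` s @^-1` C); split; first exact: cob_srcI.
    by rewrite src_srcI; apply/seteqP; split=> [z []|z Cz] //; split=> //; exact: CD.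
  by move=> _ [h [Dh _] <-]; exact: DB.
Qed.

Lemma free_embed A B : clopen A -> clopen B -> (A !=set0 -> B !=set0) ->
  A `&` B = set0 -> exists U, [/\ free_cob U, s @` U = A & r @` U `<=` B].
Proof.
move=> cA cB AB0 AB; have [U [cU sU rU]] := clopen_embed cA cB AB0.
exists U; split=> //; split=> //; rewrite sU -subset0 -AB; exact: setIS.
Qed.

(** If [z] lies outside [s(U)], [r(U)] and [r(U')], both sides are compared with
    some [tau_W] whose range lies near [z]. Otherwise [s(U)] is cut in two, and
    each half provides [z] for the other one. *)
Lemma abel_tau_src U U' t t' : free_cob U -> free_cob U' -> s @` U = s @` U' ->
  is_tau U t -> is_tau U' t' -> abel t = abel t'.
Proof.
have step V V' v v' z : free_cob V -> free_cob V' -> s @` V = s @` V' ->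
    is_tau V v -> is_tau V' v' ->
    ~ (s @` V) z -> ~ (r @` V) z -> ~ (r @` V') z -> abel v = abel v'.
  move=> fV fV' ss tV tV' sz rz rz'.
  have c1 := cob_src_clopen fV.1; have c2 := cob_rng_clopen fV.1.
  have c3 := cob_rng_clopen fV'.1.
  pose D := ~` (s @` V `|` r @` V `|` r @` V').
  have cD : clopen D by apply: clopenC => //; apply: clopenU => //; exact: clopenU.
  have Dz : D z by move=> [[]|].
  have [||W [fW sW rW]] := free_embed c1 cD.
  - by exists z.
  - by rewrite -subset0 => x [Vx] []; left; left.
  have [w tW] := tau_exists fW.1 fW.2.
  have -> : abel v = abel w.
    apply: tau_conj tV tW => //.
    by rewrite -subset0 => x [Vx /rW] []; left; right.
  apply/esym; apply: tau_conj tV' tW => //; first by rewrite sW.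
  by rewrite -subset0 => x [Vx /rW] []; right.
move=> fU fU' ss tU tU'.
have [A0|/set0P/negP/negPn/eqP A0] := pselect (s @` U !=set0); last first.
  have e V : s @` V = set0 -> V = set0.
    move=> V0; rewrite -subset0 => g Vg; suff : set0 (s g) by [].
    by rewrite -V0; exists g.
  have U0 := e _ A0; rewrite ss in A0; have U'0 := e _ A0; subst U U'.
  by rewrite (tau_unique tU tU').
have [C [cC [z1 [Az1 Cz1]] [z2 [Az2 Cz2]]]] :=
  unit_clopen_split (cob_src_clopen fU.1) A0.
have [t1 [t2 [tU1 tU2 ->]]] := tau_split fU cC tU.
have [t1' [t2' [tU1' tU2' ->]]] := tau_split fU' cC tU'.
have fI V (D : set X) : free_cob V -> clopen D -> free_cob (V `&` s @^-1` D).
  move=> fV cD; apply: free_sub (fV) _ _; last exact: subIsetl.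
  by apply: cob_srcI => //; case: fV.
have nr V (D : set X) z : free_cob V -> (s @` V) z -> ~ (r @` (V `&` s @^-1` D)) z.
  by move=> fV [g Vg <-] [h [Vh _] /esym]; exact: free_neq fV Vg Vh.
have cC' := clopenC setT cC.
rewrite !abelM; congr (_ + _).
- apply: (step _ _ _ _ z2 (fI _ _ fU cC) (fI _ _ fU' cC)) tU1 tU1' _ _ _.
  + by rewrite !src_srcI ss.
  + by rewrite src_srcI => -[].
  + exact: nr.
  + by apply: nr => //; rewrite -ss.
- apply: (step _ _ _ _ z1 (fI _ _ fU cC') (fI _ _ fU' cC')) tU2 tU2' _ _ _.
  + by rewrite !src_srcI ss.
  + by rewrite src_srcI => -[_]; exact.
  + exact: nr.
  + by apply: nr => //; rewrite -ss.
Qed.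

End Taus.

(** * The invariant measure with values in the abelianization *)

Section TauMeasure.
Variable G : cantor_groupoid.
Local Notation X := (unit_space G).
Local Notation s := (@src G).
Local Notation r := (@rng G).
Local Notation inv := (@ginv G).
Local Notation cob := (@compact_open_bisection G).
Implicit Types (g h k : G) (x y : X) (U V W : set G) (A B C : set X)
  (t v : full_group G).

Hypothesis Gmin : minimal_groupoid G.
Hypothesis Gpi : purely_infinite G.

(** The last clause, invariance under compact open G-sets, is what makes the induced map on
    functions kill boundaries. *)
Definition tau_measure (mu : set X -> abelianization (full_group G)) :=
  [/\ forall U t, free_cob U -> is_tau U t -> abel t = mu (s @` U),
      forall A B, clopen A -> clopen B -> A `&` B = set0 ->
        mu (A `|` B) = mu A + mu B,
      forall A, clopen A -> mu A + mu A = 0 &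
      forall U, cob U -> mu (s @` U) = mu (r @` U)].

(** The nonemptiness is conditional because [cantor_set] allows the empty space. *)
Lemma clopen_halving : exists C, clopen C /\
  ((exists x : X, True) -> C !=set0 /\ ~` C !=set0).
Proof.
have [[x _]|nX] := pselect (exists x : X, True); last first.
  by exists setT; split; [exact: clopenT | move/nX].
have [|C [cC C1 C2]] := unit_clopen_split (@clopenT X); first by exists x.
by exists C; rewrite !setTI in C1 C2.
Qed.

Lemma free_inv U : free_cob U -> free_cob (inv @^-1` U).
Proof.
move=> [cU U0]; split; first exact: bisection_inv.
by rewrite src_ginv_image rng_ginv_image setIC.
Qed.

Lemma free_srcI U A : free_cob U -> clopen A -> free_cob (U `&` s @^-1` A).
Proof.
move=> fU cA; apply: free_sub (fU) _ _; last exact: subIsetl.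
by apply: cob_srcI => //; case: fU.
Qed.

(** [F] recovers the class of [tau_U] from [s(U)], and [mu] extends it to every clopen set. Twice a
    value is 0 because [tau_U] is an involution. *)
Lemma tau_measure_exists : exists mu, tau_measure mu.
Proof.
pose tauP A t := exists U, [/\ free_cob U, s @` U = A & is_tau U t].
(* The value 0 is a default for sets that are not the source of any [tau_U]. *)
pose F A := if pselect (exists t, tauP A t) is left e
  then abel (projT1 (cid e)) else 0.
have FE U t : free_cob U -> is_tau U t -> F (s @` U) = abel t.
  move=> fU tU; rewrite /F; case: pselect => [e|[]]; last by exists t, U.
  case: cid => t' /= [U' [fU' ss tU']]; exact: (abel_tau_src Gmin Gpi fU' fU).
have F2 U : free_cob U -> F (s @` U) + F (s @` U) = 0.
  move=> fU; have [t tU] := tau_exists fU.1 fU.2.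
  by rewrite (FE _ _ fU tU) -abelM (tau_sq tU) abel1.
have FD U A : free_cob U -> clopen A ->
    F (s @` U) = F (s @` U `&` A) + F (s @` U `&` ~` A).
  move=> fU cA; have [t tU] := tau_exists fU.1 fU.2.
  have [t1 [t2 [tU1 tU2 e]]] := tau_split fU cA tU.
  rewrite (FE _ _ fU tU) e abelM -!src_srcI.
  rewrite (FE _ _ (free_srcI fU cA) tU1).
  by rewrite (FE _ _ (free_srcI fU (clopenC setT cA)) tU2).
have [P [cP PP]] := clopen_halving; have cP' := clopenC setT cP.
(* The part of [A] inside [Q] embeds in the complement of [Q], so it is the source of a free
   G-set. *)
have emb (A Q : set X) : clopen A -> clopen Q ->
    (A !=set0 -> ~` Q !=set0) -> exists2 U, free_cob U & s @` U = A `&` Q.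
  move=> cA cQ AQ; have cAQ := clopenI cA cQ.
  have [||U [fU sU _]] := free_embed Gmin Gpi cAQ (clopenC setT cQ).
  - by move=> [x [Ax _]]; apply: AQ; exists x.
  - by rewrite -setIA setICr setI0.
  - by exists U.
have embP A : clopen A -> exists2 U, free_cob U & s @` U = A `&` P.
  by move=> cA; apply: emb => // -[x _]; apply: (PP _).2; exists x.
have embP' A : clopen A -> exists2 U, free_cob U & s @` U = A `&` ~` P.
  move=> cA; apply: emb => // -[x _]; rewrite setCK.
  by apply: (PP _).1; exists x.
(* No [tau_U] has the whole unit space as its source, hence the cut by [P]. *)
pose mu A := F (A `&` P) + F (A `&` ~` P).
have muF U : free_cob U -> mu (s @` U) = F (s @` U).
  by move=> fU; rewrite /mu -(FD _ _ fU cP).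
have muD A B : clopen A -> clopen B -> A `&` B = set0 -> mu (A `|` B) = mu A + mu B.
  move=> cA cB AB; have cAB := clopenU cA cB.
  have [U fU sU] := embP _ cAB; have [V fV sV] := embP' _ cAB.
  have BA : B `&` ~` A = B.
    by apply/setIidPl => x Bx Ax; suff : set0 x by []; rewrite -AB.
  have e C : F ((A `|` B) `&` C `&` A) + F ((A `|` B) `&` C `&` ~` A) =
      F (A `&` C) + F (B `&` C).
    congr (F _ + F _); rewrite setIAC setIUl.
      by rewrite setIid [B `&` A]setIC AB setU0.
    by rewrite setICr set0U BA.
  rewrite /mu -sU -sV (FD _ _ fU cA) (FD _ _ fV cA) sU sV !e addrACA //.
exists mu; split=> //.
- by move=> U t fU tU; rewrite muF // (FE _ _ fU tU).
- move=> A cA; rewrite /mu addrACA.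
  have [U fU <-] := embP _ cA; have [V fV <-] := embP' _ cA.
  by rewrite !F2 // addr0.
(* [tau_U] is also the element attached to the inverse G-set, whose source is [r(U)]. *)
have muS U : free_cob U -> mu (s @` U) = mu (r @` U).
  move=> fU; have [t tU] := tau_exists fU.1 fU.2.
  rewrite -src_ginv_image !muF //; last exact: free_inv.
  by rewrite (FE _ _ fU tU) (FE _ _ (free_inv fU) (tau_inv tU)).
have mu0 : mu set0 = 0.
  by apply: (addrI (mu set0)); rewrite -muD ?setU0 ?addr0 ?setI0 //; exact: clopen0.
move=> U cU; have [kU oU _] := cU.
(* The inclusion in [U] is kept in the induction so that every piece is a G-set. *)
suff : U `<=` U -> mu (s @` U) = mu (r @` U) by apply.
apply: (@compact_open_ind _ (@arrow_hausdorff G)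
  (fun V => V `<=` U -> mu (s @` V) = mu (r @` V))) => //.
- by rewrite !image_set0.
- move=> V W kV oV kW oW VW eV eW; rewrite subUset => -[VU WU].
  have cV := cob_subset cU kV oV VU; have cW := cob_subset cU kW oW WU.
  have N g h : V g -> W h -> g <> h.
    by move=> Vg Wh gh; suff : set0 g by []; rewrite -VW; split=> //; rewrite gh.
  rewrite !image_setU muD; [|exact: cob_src_clopen|exact: cob_src_clopen|]; last first.
    rewrite -subset0 => x [[g Vg <-] [h Wh /esym]].
    by move/(cob_src_inj cU (VU _ Vg) (WU _ Wh)); exact: N.
  rewrite muD; [|exact: cob_rng_clopen|exact: cob_rng_clopen|]; last first.
    rewrite -subset0 => x [[g Vg <-] [h Wh /esym]].
    by move/(cob_rng_inj cU (VU _ Vg) (WU _ Wh)); exact: N.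
  by rewrite eV // eW.
(* A nonempty clopen [C] away from [s(g)] and [r(g)] leaves room for a third set: for [V] near [g],
   free G-sets join both [s(V)] and [r(V)] to the same subset [r(W)] of [C]. *)
- move=> g Ug.
  have [|C1 [cC1 _ C10 C1s]] := @clopen_avoid G setT (s g) (@clopenT X).
    by exists (s g).
  have [C [cC CC1 C0 Cr]] := clopen_avoid (r g) cC1 C10.
  have nC := clopenC setT cC.
  have cD := cob_rngI (cob_srcI cU nC) nC; have [kD oD _] := cD.
  eexists; split; [exact: kD|exact: oD|by split=> //; split=> //= /CC1|].
  move=> V kV oV VD VU; have cV := cob_subset cU kV oV VU.
  have [U1|W [cW sW rW]] := clopen_embed Gmin Gpi (cob_src_clopen cV) cC; first by [].
  have WC (A : set X) : A `<=` ~` C -> A `&` r @` W = set0.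
    by move=> AC; rewrite -subset0 => x [/AC nCx /rW].
  have sVC : s @` V `<=` ~` C by move=> _ [h /VD[[_ ?] _] <-].
  have rVC : r @` V `<=` ~` C by move=> _ [h /VD[_ ?] <-].
  have fW : free_cob W by split=> //; rewrite sW; apply: WC.
  pose W' := bisection_mul W (inv @^-1` V).
  have sW' : s @` W' = r @` V.
    by rewrite src_bisection_mul ?src_ginv_image // rng_ginv_image sW.
  have rW' : r @` W' = r @` W by rewrite rng_bisection_mul // rng_ginv_image sW.
  have fW' : free_cob W'.
    split; first by apply: cob_mul => //; exact: bisection_inv.
    by rewrite sW' rW'; exact: WC.
  by rewrite -sW -sW' muS // muS // rW'.
Qed.

End TauMeasure.

(** * Measuring odd sets: the map on homology in degree 0 *)

Section OddMeasure.
Variable G : cantor_groupoid.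
Local Notation X := (unit_space G).
Local Notation s := (@src G).
Local Notation r := (@rng G).
Local Notation ab := (abelianization (full_group G)).
Implicit Types (A B : set X) (U : set G).

Variable mu : set X -> ab.
Hypothesis mmu : tau_measure mu.

Definition odd_set (f : X -> int) : set X := [set x | odd `|f x|%N].

Lemma odd_set_clopen (f : Cc X) : clopen (odd_set f).
Proof.
have cf := (int_continuousP _).1 (@Cc_continuous _ f); split.
  by rewrite openE => x Ax; apply: filterS (cf x) => y /= e; rewrite /odd_set /= e.
rewrite -[odd_set f]setCK; apply: open_closedC; rewrite openE => x nAx.
by apply: filterS (cf x) => y /= e; rewrite /odd_set /= e.
Qed.

Lemma odd_setB (f g : Cc X) :
  odd_set (Cc_fun (f - g)) = odd_set f `\` odd_set g `|` odd_set g `\` odd_set f.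
Proof.
have oE x : odd_set (Cc_fun (f - g)) x = (odd `|f x|%N (+) odd `|g x|%N) :> Prop.
  by rewrite /odd_set /mkset CcB; congr is_true; lia.
apply/seteqP; split=> x; rewrite oE /odd_set /=.
  by case: (odd `|f x|%N) (odd `|g x|%N) => -[] //= _; [left|right].
by case: (odd `|f x|%N) (odd `|g x|%N) => -[] [] // [].
Qed.

Lemma mu_torsion A : clopen A -> - mu A = mu A.
Proof. by move=> cA; apply/esym/eqP; rewrite -addr_eq0; case: mmu => _ _ ->. Qed.

Lemma mu0 : mu set0 = 0.
Proof.
have [_ mD _ _] := mmu; apply: (addrI (mu set0)).
by rewrite -mD ?setU0 ?addr0 ?setI0 //; exact: clopen0.
Qed.

Lemma mu_setID A B : clopen A -> clopen B -> mu A = mu (A `&` B) + mu (A `\` B).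
Proof.
move=> cA cB; have [_ mD _ _] := mmu.
rewrite -mD ?setUIDK //; first exact: clopenI.
  by rewrite setDE; apply: clopenI => //; exact: clopenC.
by rewrite setDE setIACA setICr setI0.
Qed.

Definition odd_mu (f : Cc X) : ab := mu (odd_set f).

(** The odd set of [f - g] is the symmetric difference of the two odd sets. The common part cancels,
    and the sign does not matter because values of [mu] are 2-torsion. *)
Lemma odd_mu_additive : zmod_morphism odd_mu.
Proof.
move=> f g; have [_ mD _ _] := mmu.
have cf := odd_set_clopen f; have cg := odd_set_clopen g.
have cD A B : clopen A -> clopen B -> clopen (A `\` B).
  by move=> cA cB; rewrite setDE; apply: clopenI => //; exact: clopenC.
rewrite /odd_mu odd_setB mD; [|exact: cD|exact: cD|]; last first.
  by rewrite -subset0 => x [[_ ngx] [gx _]].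
rewrite (mu_setID cf cg) (mu_setID cg cf) [odd_set g `&` _]setIC.
by rewrite opprD addrACA subrr add0r (mu_torsion (cD _ _ cg cf)).
Qed.

HB.instance Definition _ := GRing.isZmodMorphism.Build _ _ odd_mu odd_mu_additive.

Lemma odd_mu_chi A : clopen A -> odd_mu (chi (@unit_space_hausdorff G) A) = mu A.
Proof.
move=> cA; rewrite /odd_mu; congr mu; apply/seteqP.
have kA := clopen_compact cA; have oA := cA.1.
split=> x; rewrite /odd_set /= chiE //; last by move=> Ax; rewrite mem_set.
by case: (boolP (x \in A)) => //; rewrite inE.
Qed.

(** By [Cc_ind] only the indicator of a compact open G-set [U] matters; its boundary is the
    indicator of [s(U)] minus that of [r(U)], and [mu] agrees on these sets. *)
Lemma odd_mu_boundary (b : Cc X) (h : Cc G) : boundary1 h = b -> odd_mu b = 0.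
Proof.
(* [boundary1 h] is a bare function, so the induction also produces the element of [Cc] that it
   equals. *)
suff [b' hb' b'0] : exists2 b', boundary1 h = Cc_fun b' & odd_mu b' = 0.
  by rewrite hb' => e; have <- : b' = b by apply: val_inj.
elim/Cc_ind: h => [|f f' [b1 f1 e1] [b2 f2 e2]|U cU].
- by exists 0; [rewrite -[0 in LHS](subrr 0) boundary1B subrr | exact: raddf0].
- by exists (b1 - b2); [rewrite boundary1B f1 f2 | rewrite raddfB /= e1 e2 subrr].
- have [kU oU _] := cU; have cs := cob_src_clopen cU; have cr := cob_rng_clopen cU.
  have [_ _ [ri si]] := cU.
  exists (chi (@unit_space_hausdorff G) (s @` U) -
          chi (@unit_space_hausdorff G) (r @` U)).
    rewrite /boundary1 !pushforward_chi //; apply/funext => x.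
    rewrite CcB !chiE //; [exact: clopen_compact | by case: cr |
      exact: clopen_compact | by case: cs].
  rewrite raddfB /= !odd_mu_chi //; have [_ _ _ ->//] := mmu.
  by rewrite subrr.
Qed.

Lemma H0_lift : exists j0 : {additive H0 G -> ab}, forall f, j0 (class0 f) = odd_mu f.
Proof.
have [|j0 j0E] := quot_lift (f := odd_mu : {additive _ -> _}) (S := @B0_pred G).
  by move=> b; rewrite unfold_in => /asboolP[h hb]; exact: odd_mu_boundary hb.
by exists j0.
Qed.

End OddMeasure.

(** * Transpositions *)

Section Transpositions.
Variable G : cantor_groupoid.
Local Notation X := (unit_space G).
Local Notation s := (@src G).
Local Notation r := (@rng G).
Local Notation inv := (@ginv G).
Local Notation cob := (@compact_open_bisection G).
Implicit Types (g h k : G) (x y : X) (U V W : set G) (A B C : set X)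
  (t v : full_group G).

Lemma full_group_continuous t : continuous (\val t).
Proof. by have [[ct _] _] := set_valP t. Qed.

Lemma involution_cancel t : (t * t = 1)%g -> involutive (\val t).
Proof. by move=> tt x; rewrite -[RHS]/(\val (1%g : full_group G) x) -tt. Qed.

(** [A] is a fundamental domain for [t] on the points it moves. Near a moved point there is a clopen
    set disjoint from its image; a domain [A2] is glued to [A1] by removing from [A2] what [A1] and
    its image already cover. *)
Lemma involution_domain t : transposition t -> exists A,
  [/\ clopen A, A `&` \val t @^-1` A = set0 &
      A `|` \val t @^-1` A = [set x | \val t x <> x]].
Proof.
move=> [/involution_cancel tK cfix]; set f := \val t in tK cfix *.
have cf : continuous f by exact: full_group_continuous.
pose Y := [set x | f x <> x].
have cY : clopen Y by apply: (clopenC setT cfix).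
have YE : Y `|` f @^-1` Y = Y.
  by apply/seteqP; split=> x; [case=> //; rewrite /Y /= tK => /nesym | left].
(* The claim is stated with the saturation of [Y], since the pieces in the induction need not be
   invariant. *)
suff [A [cA A0 AE]] : exists A, [/\ clopen A, A `&` f @^-1` A = set0 &
    A `|` f @^-1` A = Y `|` f @^-1` Y] by exists A; rewrite AE YE.
apply: (@compact_open_ind _ (@unit_space_hausdorff G) (fun C => exists A,
  [/\ clopen A, A `&` f @^-1` A = set0 & A `|` f @^-1` A = C `|` f @^-1` C])).
- by exists set0; rewrite set0I; split=> //; exact: clopen0.
- move=> C1 C2 _ _ _ _ _ [A1 [cA1 A10 A1E]] [A2 [cA2 A20 A2E]].
  have cP A : clopen A -> clopen (f @^-1` A) by move=> cA; exact: preimage_clopen.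
  have N1 x : A1 x -> A1 (f x) -> False.
    by move=> A1x A1fx; suff : set0 x by []; rewrite -A10.
  have N2 x : A2 x -> A2 (f x) -> False.
    by move=> A2x A2fx; suff : set0 x by []; rewrite -A20.
  exists (A1 `|` (A2 `\` (A1 `|` f @^-1` A1))); split.
  + apply: clopenU => //; rewrite setDE; apply: clopenI => //.
    by apply: clopenC => //; apply: clopenU => //; exact: cP.
  + rewrite -subset0 => x [[A1x|[A2x nA1x]] [A1fx|[A2fx nA1fx]]].
    * exact: N1 A1x A1fx.
    * by apply: nA1fx; right; rewrite /= tK.
    * by apply: nA1x; right.
    * exact: N2 A2x A2fx.
  + rewrite !preimage_setU [RHS]setUACA -A1E -A2E; apply/seteqP; split=> x.
      move=> [[A1x|[A2x nA1x]]|[A1x|[A2x nA1x]]].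
      * by left; left.
      * by right; left.
      * by left; right.
      * by right; right.
    move=> [[A1x|A1x]|[A2x|A2x]].
    * by left; left.
    * by right; left.
    * have [A1x|nA1x] := pselect ((A1 `|` f @^-1` A1) x); last by left; right.
      by case: A1x; [left; left | right; left].
    * have [[A1x|A1x]|nA1x] := pselect ((A1 `|` f @^-1` A1) (f x)).
      - by right; left.
      - by left; left; rewrite -(tK x).
      - by right; right.
- exact: clopen_compact.
- by case: cY.
- move=> x Yx; have xfx : x != f x by apply/eqP => /esym.
  have [D [cD Dx nDfx]] := unit_zero_dimensional xfx.
  have cDD : clopen (D `&` f @^-1` (~` D)).
    by apply: clopenI => //; apply: preimage_clopen => //; exact: clopenC.
  exists (D `&` f @^-1` (~` D)); split=> //; [exact: clopen_compact | by case: cDD |].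
  move=> C kC oC CD; exists C; split=> //.
    by split=> //; apply: compact_closed kC; exact: unit_space_hausdorff.
  rewrite -subset0 => y [Cy Cfy].
  by have [_ /=] := CD _ Cy; apply; case: (CD _ Cfy).
Qed.

(** Restricting the G-set of [t] to sources in a fundamental domain gives [U]. *)
Lemma transposition_tau t : transposition t -> exists2 U, free_cob U & is_tau U t.
Proof.
move=> tt; have [A [cA A0 AE]] := involution_domain tt.
have [/involution_cancel tK _] := tt.
have [W [[cW sW rW] Wt]] := full_group_bisection t.
exists (W `&` s @^-1` A); first split.
- exact: cob_srcI.
- rewrite -subset0 => x [[h [Wh Ah] <-] [g [Wg Ag] gh]].
  suff : set0 (s g) by []; rewrite -A0; split=> //=.
  by rewrite Wt // gh.
split=> [g [Wg Ag]|g [Wg Ag]|x nsx nrx]; first exact: Wt.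
  by rewrite -(Wt _ Wg) tK.
apply: contrapT => tx; have : (A `|` \val t @^-1` A) x by rewrite AE.
move=> [Ax|Atx].
  have [g Wg gx] : (s @` W) x by rewrite sW.
  by apply: nsx; exists g => //; split=> //=; rewrite gx.
have [g Wg gx] : (s @` W) (\val t x) by rewrite sW.
by apply: nrx; exists g; [split=> //=; rewrite gx | rewrite -Wt // gx tK].
Qed.

(** The G-set [W] of [t] is the disjoint union of its part over [s(U)], the inverse of that part,
    and units, so its class is [c - c + 0]. *)
Lemma full_index_tau U t : free_cob U -> is_tau U t -> full_index t = 0.
Proof.
move=> [cU U0] tU; have tK := involution_cancel (tau_sq tU).
have [ts tr tf] := tU.
have [W [fW Wt]] := full_group_bisection t; have [cW sW rW] := fW.
(* As [t] is an involution, [W] and its inverse define the same homeomorphism, so they coincide. *)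
have WV : inv @^-1` W = W.
  apply: (theta_unique (full_bisection_inv fW) fW _ Wt) => g Wg.
  by rewrite -rng_ginv -Wt // src_ginv tK.
have cA := cob_src_clopen cU; have cB := cob_rng_clopen cU.
set A := s @` U in U0 cA; set B := r @` U in U0 cB.
have cC : clopen (~` (A `|` B)) by apply: clopenC => //; exact: clopenU.
pose W1 := W `&` s @^-1` A; pose W2 := W `&` s @^-1` B.
pose W3 := W `&` s @^-1` (~` (A `|` B)).
have c1 : cob W1 by exact: cob_srcI.
have c2 : cob W2 by exact: cob_srcI.
have c3 : cob W3 by exact: cob_srcI.
have W2E : W2 = inv @^-1` W1.
  apply/seteqP; split=> g.
    move=> [Wg [h Uh hg]]; have Wg' := Wg; rewrite -WV in Wg'; split=> //=.
    by rewrite src_ginv -Wt // -hg tr //; exists h.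
  move=> [Wg /= Ag]; have Wg' : W g by rewrite -WV.
  rewrite src_ginv in Ag; move: Ag => [h Uh hg]; split=> //=.
  by rewrite -[s g]tK (Wt _ Wg') -hg ts //; exists h.
have sr g : W3 g -> r g = s g.
  by move=> [Wg /= nAB]; rewrite -Wt // tf // => ?; apply: nAB; [left | right].
(* [W3] is an open set of arrows with equal source and range, so essential principality puts it in
   the units. *)
have W3G g : W3 g -> units G g.
  move=> W3g; rewrite -(@cantor_essentially_principal G).
  have : nbhs g W3 by apply: open_nbhs_nbhs; split=> //; case: c3.
  by apply: filterS => h /sr.
have W3E : W3 = units_on (~` (A `|` B)).
  rewrite units_onE; apply/seteqP; split=> g.
    by move=> W3g; split; [exact: W3G | rewrite /= sr //; case: W3g].
  move=> [Gg nAB]; have [h Wh hg] : (s @` W) (r g) by rewrite sW.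
  have W3h : W3 h by split=> //=; rewrite hg.
  suff -> : g = h by [].
  by rewrite -(unit_spaceP Gg) -(unit_spaceP (W3G _ W3h)) (sr _ W3h) hg.
have WE : W = (W1 `|` W2) `|` W3.
  by rewrite -!setIUr -!preimage_setU setUv preimage_setT setIT.
have c12 : cob (W1 `|` W2).
  rewrite -setIUr -preimage_setU; apply: cob_srcI => //; exact: clopenU.
rewrite (full_index_theta fW Wt) -[RHS](raddf0 (\pi_(Quotient.quot (@B1_pred G)))).
apply/(@class1_eq G (bisection_cycle fW) 0); rewrite bisection_cycleE.
have -> : cls (Z1_Cc (0 : Z1 G)) = 0 by exact: cls0.
rewrite WE cls_onesU //; last first.
  by rewrite -setIUr -preimage_setU setIACA -preimage_setI setICr preimage_set0 setI0.
rewrite cls_onesU //; last by rewrite setIACA -preimage_setI U0 preimage_set0 setI0.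
by rewrite W2E cls_inv // W3E cls_units_on // subrr addr0.
Qed.

Variable mu : set X -> abelianization (full_group G).
Hypothesis mmu : tau_measure mu.

Lemma mu_bigcup n (A : 'I_n -> set X) : (forall i, clopen (A i)) ->
  trivIset setT A -> mu (\bigcup_i A i) = \sum_i mu (A i).
Proof.
move=> cA tA; have [_ mD _ _] := mmu.
have -> : \bigcup_i A i = \big[setU/set0]_i A i.
  rewrite -bigcup_seq; apply/seteqP; split=> x [i _ Ax]; exists i => //=.
  exact: mem_index_enum.
have : uniq (index_enum 'I_n) by exact: index_enum_uniq.
elim: (index_enum 'I_n) => [|i l IHl] /=; first by rewrite !big_nil mu0.
move=> /andP[il ul]; rewrite !big_cons mD ?IHl //.
  elim/big_ind: _ => // [|B C]; [exact: clopen0 | exact: clopenU].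
rewrite -subset0 => x [Aix]; rewrite -bigcup_seq => -[j /= jl Ajx].
have ij : i = j by apply: (tA i j) => //; exists x.
by move: il; rewrite ij jl.
Qed.

(** The right side depends on [f] alone: this is the independence of [j] from the choices. *)
Lemma abel_tau_choice (f : Cc X) n (U : 'I_n -> set G) (t : 'I_n -> full_group G) :
  tau_choice f U t -> abel (\prod_(i < n) t i)%g = odd_mu mu f.
Proof.
move=> [UP tU UE]; rewrite /odd_mu /odd_set -UE mu_bigcup //; last first.
  by move=> i; apply: cob_src_clopen; case: (UP i).
rewrite (big_morph _ (@abelM _) (@abel1 _)); apply: eq_bigr => i _.
by have [cU U0 ti] := UP i; have [muE _ _ _] := mmu; exact: muE ti.
Qed.

End Transpositions.

(** * Existence of the data from which [j] is computed *)

Section TauChoice.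
Variable G : cantor_groupoid.
Hypothesis Gmin : minimal_groupoid G.
Hypothesis Gpi : purely_infinite G.

(** The odd set may be the whole unit space, so it is cut by [P] and each piece is embedded in the
    opposite half; two G-sets suffice. *)
Lemma tau_choice_exists (f : Cc (unit_space G)) :
  exists n (U : 'I_n -> set G) (t : 'I_n -> full_group G), tau_choice f U t.
Proof.
have cO := odd_set_clopen f; set O := odd_set f in cO.
have [P [cP PP]] := clopen_halving G; have cP' := clopenC setT cP.
have [||U0 [f0 s0 _]] := free_embed Gmin Gpi (clopenI cO cP) cP'.
- by move=> [x _]; apply: (PP _).2; exists x.
- by rewrite -setIA setICr setI0.
have [||U1 [f1 s1 _]] := free_embed Gmin Gpi (clopenI cO cP') cP.
- by move=> [x _]; apply: (PP _).1; exists x.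
- by rewrite -setIA setICl setI0.
have [t0 t0P] := tau_exists f0.1 f0.2; have [t1 t1P] := tau_exists f1.1 f1.2.
exists 2%N, (fun i => if i == 0 then U0 else U1),
  (fun i => if i == 0 then t0 else t1).
split.
- by move=> i; case: ifP => _; [case: f0 | case: f1].
- move=> i j _ _ [x []].
  have [i0|i0] := ifP; have [j0|j0] := ifP; rewrite ?s0 ?s1.
  + by rewrite (eqP i0) (eqP j0).
  + by move=> [_ ?] [_].
  + by move=> [_ ?] [_].
  + move=> _ _; apply: val_inj; move: i0 j0; rewrite -!val_eqE /=.
    by case: (val i) (ltn_ord i) (val j) (ltn_ord j) => [|[|?]] // _ [|[|?]].
- rewrite -[RHS](setIT O) -(setUv P) setIUr -s0 -s1; apply/seteqP; split=> x.
    by move=> [i _]; case: ifP => _; [left | right].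
  by move=> [Ux|Ux]; [exists 0 | exists 1].
Qed.

End TauChoice.

(** * Surjectivity of the index map *)

(** Tuples with equally many [true] entries are rearrangements of each other. At each point this
    matches the ranges containing it with the sources containing it. *)
Lemma bool_perm n (a b : n.-tuple bool) : count id a = count id b ->
  exists p : 'S_n, forall i, tnth a i = tnth b (p i).
Proof.
move=> ab.
have countE (q : pred bool) (l : seq bool) :
    count q l = (q true * count id l + q false * (size l - count id l))%N.
  elim: l => [|[] l IHl] /=; first by rewrite !muln0.
    by rewrite IHl subSS mulnDr muln1 addnA.
  by rewrite IHl add0n subSn ?count_size // mulnS addnCA.
have /tuple_permP[p pE] : perm_eq a b.
  by apply/seq.permP => q; rewrite (countE q a) (countE q b) !size_tuple ab.
by exists p => i; rewrite (tnth_nth false) pE -tnth_nth tnth_mktuple.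
Qed.

Section Surjectivity.
Variable G : cantor_groupoid.
Local Notation X := (unit_space G).
Local Notation s := (@src G).
Local Notation r := (@rng G).
Local Notation inv := (@ginv G).
Local Notation cob := (@compact_open_bisection G).
Implicit Types (g h k : G) (x y : X) (A B C : set X).

Lemma cob_bigcup n (E : 'I_n -> set G) : (forall j, cob (E j)) ->
  trivIset setT (fun j => s @` E j) -> trivIset setT (fun j => r @` E j) ->
  cob (\bigcup_j E j) /\ cls (ones (\bigcup_j E j)) = \sum_j cls (ones (E j)).
Proof.
move=> cE tS tR.
have -> : \bigcup_j E j = \big[setU/set0]_j E j.
  rewrite -bigcup_seq; apply/seteqP; split=> x [i _ Ax]; exists i => //=.
  exact: mem_index_enum.
have : uniq (index_enum 'I_n) by exact: index_enum_uniq.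
elim: (index_enum 'I_n) => [|i l IHl] /=.
  rewrite !big_nil => _; split; first exact: cob0.
  by rewrite /ones chi0 cls0.
move=> /andP[il ul]; rewrite !big_cons; have [cl <-] := IHl ul.
have dsj (p : G -> X) : trivIset setT (fun j => p @` E j) ->
    p @` E i `&` p @` (\big[setU/set0]_(j <- l) E j) = set0.
  move=> tp; rewrite -bigcup_seq -subset0 => x [pix [g [j /= jl Ejg] gx]].
  have ij : i = j by apply: (tp i j) => //; exists x; split=> //; exists g.
  by move: il; rewrite ij jl.
have e : E i `&` \big[setU/set0]_(j <- l) E j = set0.
  rewrite -subset0 => g [Eg lg].
  suff : set0 (s g) by []; rewrite -(dsj _ tS).
  by split; exists g.
by split; [apply: cobU => //; exact: dsj | exact: cls_onesU].
Qed.

Lemma boundary1_ones U : cob U ->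
  boundary1 (ones U) = fun x => (x \in s @` U)%:Z - (x \in r @` U)%:Z.
Proof.
move=> [kU oU [ri si]].
by apply/funext => x; rewrite /boundary1 /ones !pushforward_chi.
Qed.

(** A difference becomes a sum because replacing [U] by its inverse negates both the class and the
    boundary. *)
Lemma cls_decomposition (h : Cc G) : exists l : seq (set G),
  [/\ forall U, U \in l -> cob U, cls h = \sum_(U <- l) cls (ones U) &
      forall x, boundary1 h x =
        \sum_(U <- l) ((x \in s @` U)%:Z - (x \in r @` U)%:Z)].
Proof.
elim/Cc_ind: h => [|f f' [l [cl fl bl]] [l' [cl' fl' bl']]|U cU].
- exists [::]; split=> //; first by rewrite big_nil cls0.
  by move=> x; rewrite big_nil -[0 in LHS](subrr 0) boundary1B subrr.
- exists (l ++ [seq inv @^-1` U | U <- l']); split.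
  + move=> U; rewrite mem_cat => /orP[/cl//|/mapP[V /cl' cV ->]].
    exact: bisection_inv.
  + rewrite clsD clsN big_cat big_map /= fl fl'; congr (_ + _).
    rewrite -sumrN big_seq [RHS]big_seq; apply: eq_bigr => U /cl' cU.
    by rewrite cls_inv.
  + move=> x; have -> : boundary1 (f - f') x = boundary1 f x - boundary1 f' x.
      by rewrite boundary1B.
    rewrite bl bl' big_cat big_map /=; congr (_ + _).
    rewrite -sumrN; apply: eq_bigr => U _.
    by rewrite src_ginv_image rng_ginv_image opprB.
- exists [:: U]; split; first by move=> V; rewrite inE => /eqP ->.
    by rewrite big_seq1.
  by move=> x; rewrite big_seq1 boundary1_ones.
Qed.

Lemma clopen_locally_constant A x : clopen A ->
  \forall y \near x, (y \in A) = (x \in A).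
Proof.
move=> [oA cA]; have [Ax|nAx] := boolP (x \in A).
  apply: (filterS (P := A)); first by move=> y Ay; rewrite mem_set.
  by apply: open_nbhs_nbhs; split=> //; rewrite inE in Ax.
apply: (filterS (P := ~` A)); first by move=> y Ay; rewrite memNset.
apply: open_nbhs_nbhs; split; first exact: closed_openC.
by move: nAx; rewrite notin_setE.
Qed.

Hypothesis Gmin : minimal_groupoid G.
Hypothesis Gpi : purely_infinite G.

(** By induction inside a clopen [B]: the unit space is embedded in one half of [B] and the
    remaining copies in the other half. *)
Lemma disjoint_copies n : exists V : 'I_n -> set G,
  (forall i, cob (V i) /\ s @` V i = setT) /\
  trivIset setT (fun i => r @` V i).
Proof.
suff : forall B, clopen B -> ([set: X] !=set0 -> B !=set0) ->
    exists V : nat -> set G,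
    [/\ forall i, (i < n)%N -> [/\ cob (V i), s @` V i = setT & r @` V i `<=` B] &
        forall i j, (i < j < n)%N -> r @` V i `&` r @` V j = set0].
  move=> /(_ setT (@clopenT X) id)[V [VP VD]]; exists V; split.
    by move=> i; case: (VP i (ltn_ord i)).
  move=> i j _ _ [x [ix jx]]; apply: val_inj; case: (ltngtP i j) => // ij.
    by suff : set0 x by []; rewrite -(VD i j) // ij ltn_ord.
  by suff : set0 x by []; rewrite -(VD j i) // ij ltn_ord.
elim: n => [|n IHn] B cB B0; first by exists (fun=> set0); split=> // i j /andP[].
have [C [cC CP]] : exists C, clopen C /\
    ([set: X] !=set0 -> B `&` C !=set0 /\ B `&` ~` C !=set0).
  have [/B0 B1|nX] := pselect ([set: X] !=set0); last first.
    by exists setT; split; [exact: clopenT|].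
  by have [C [cC C1 C2]] := unit_clopen_split cB B1; exists C.
have [|V0 [c0 s0 r0]] := clopen_embed Gmin Gpi (@clopenT X) (clopenI cB cC).
  by move=> /CP[].
have [|V [VP VD]] := IHn _ (clopenI cB (clopenC setT cC)); first by move=> /CP[].
exists (fun i => if i is j.+1 then V j else V0); split.
  case=> [|i] iB; first by split=> //; move=> x /r0[].
  by have [? ? rV] := VP i iB; split=> // x /rV[].
case=> [|i] [|j] // ij; last exact: VD.
have [_ _ rV] := VP j ij.
by rewrite -subset0 => x [/r0[_ Cx] /rV[_]].
Qed.

(** The single G-set is the union of the products [W_i U_i Y_i^-1], where [Y_i] moves [s(U_i)] and
    [W_i] moves [r(U_i)] into the disjoint copies. *)
Lemma full_index_surj (q : H1 G) : exists f : full_group G, full_index f = q.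
Proof.
have [z <-] : exists z : Z1 G, class1 z = q by exists (repr q); rewrite /class1 reprK.
have [l [cl zl bl]] := cls_decomposition z.
set n := size l; pose U (i : 'I_n) := nth set0 l i.
have cU i : cob (U i) by apply/cl/mem_nth.
have clsU : cls z = \sum_i cls (ones (U i)).
  by rewrite zl (big_nth set0) big_mkord.
(* [a x] and [b x] record which ranges and which sources contain [x]; for a cycle they have equally
   many [true] entries. *)
pose a x : n.-tuple bool := [tuple x \in r @` U i | i < n].
pose b x : n.-tuple bool := [tuple x \in s @` U i | i < n].
have sumE (c : 'I_n -> bool) : \sum_i (c i)%:Z = (count id [tuple c i | i < n])%:Z.
  rewrite count_map -sum1_count (big_morph Posz PoszD (erefl _)) [RHS]big_mkcond /=.
  by rewrite -[LHS]big_enum; apply: eq_bigr => i _; case: (c i).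
have ab x : count id (a x) = count id (b x).
  suff /eqP : (count id (a x))%:Z = (count id (b x))%:Z by move/eqP; case.
  have z0 : boundary1 z = 0 by have /eqP := valP z.
  rewrite -!sumE; apply/esym/eqP; rewrite -subr_eq0 -sumrB; apply/eqP.
  have := bl x; rewrite z0 (big_nth set0) big_mkord => <-.
  by [].
pose sg x : 'S_n := projT1 (cid (bool_perm (ab x))).
(* The choice of [sg x] depends only on [a x] and [b x], so it is locally constant in [x]. *)
have sgab x y : a x = a y -> b x = b y -> sg x = sg y.
  rewrite /sg => ea eb; move: (ab x) (ab y); rewrite ea eb => e1 e2.
  by rewrite (Prop_irrelevance e1 e2).
have sgP x i : (x \in r @` U i) = (x \in s @` U (sg x i)).
  have := projT2 (cid (bool_perm (ab x))) i.
  by rewrite /= !tnth_mktuple.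
have sg_near x : \forall y \near x, sg y = sg x.
  have nr : \forall y \near x, forall i, (y \in r @` U i) = (x \in r @` U i).
    have H i := clopen_locally_constant x (cob_rng_clopen (cU i)).
    exact: filter_forall H.
  have ns : \forall y \near x, forall i, (y \in s @` U i) = (x \in s @` U i).
    have H i := clopen_locally_constant x (cob_src_clopen (cU i)).
    exact: filter_forall H.
  apply: filterS2 nr ns => y er es.
  by apply: sgab; apply: eq_from_tnth => i; rewrite !tnth_mktuple.
have cS i j : clopen [set x | sg x i = j].
  split; first by rewrite openE => x /= e; apply: filterS (sg_near x) => y /= ->.
  rewrite -[X in closed X]setCK; apply: open_closedC; rewrite openE => x /= e.
  by apply: filterS (sg_near x) => y /= ->.
have [V [VP VD]] := disjoint_copies n.
pose Y j := V j `&` s @^-1` (s @` U j).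
have cY j : cob (Y j) by apply: cob_srcI; [case: (VP j) | exact: cob_src_clopen].
have sY j : s @` Y j = s @` U j by rewrite src_srcI (VP j).2 setTI.
have Yinj i j g h : Y i g -> Y j h -> r g = r h -> i = j /\ g = h.
  move=> [Vg _] [Vh _] gh; have ij : i = j.
    by apply: (VD i j) => //; exists (r g); split; [exists g | exists h].
  by rewrite -ij in Vh; split=> //; apply: (cob_rng_inj (VP i).1).
(* The points of [r(U_i)] matched with the source of index [j]; for fixed [j] these sets partition
   [s(U_j)]. *)
pose C i j := r @` U i `&` [set x | sg x i = j].
have cC i j : clopen (C i j) by apply: clopenI => //; exact: cob_rng_clopen.
pose E i j := Y j `&` s @^-1` (C i j).
have cE i j : cob (E i j) by exact: cob_srcI.
have sE i j : s @` E i j = C i j.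
  rewrite src_srcI sY; apply/seteqP; split=> [x []//|x Cx]; split=> //.
  by case: Cx => rx <-; apply/set_mem; rewrite -sgP mem_set.
(* [W_i] moves each point [x] of [r(U_i)] into the copy of index [sg x i]. *)
pose W i := \bigcup_j E i j.
have [cW clsW] : (forall i, cob (W i)) /\
    forall i, cls (ones (W i)) = \sum_j cls (ones (E i j)).
  suff H i : cob (W i) /\ cls (ones (W i)) = \sum_j cls (ones (E i j)).
    by split=> i; case: (H i).
  apply: cob_bigcup => //.
    by move=> j k _ _ [x []]; rewrite !sE => -[_ /= <-] [_ /= <-].
  move=> j k _ _ [_ [[g [Yg _] <-] [h [Yh _] /esym gh]]].
  by case: (Yinj _ _ _ _ Yg Yh gh).
have YE j : Y j = \bigcup_i E i j.
  apply/seteqP; split=> [g Yg|g [i _ []] //].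
  exists ((sg (s g))^-1%g j) => //; split=> //.
  have Uj : s g \in s @` U j by rewrite inE -sY; exists g.
  split; last by rewrite /= permKV.
  by apply/set_mem; rewrite sgP permKV.
have clsY j : cls (ones (Y j)) = \sum_i cls (ones (E i j)).
  rewrite {1}YE; apply: (cob_bigcup _ _ _).2 => //.
    by move=> i k _ _ [x []]; rewrite !sE => -[_ /= <-] [_ /= /perm_inj ->].
  move=> i k _ _ [_ [[g [Yg [_ /= gi]] <-] [h [Yh [_ /= hk]] /esym gh]]].
  have [_ e] := Yinj _ _ _ _ Yg Yh gh; rewrite e in gi.
  by apply: (@perm_inj _ (sg (s h))); rewrite gi hk.
have sW i : s @` W i = r @` U i.
  rewrite image_bigcup; apply/seteqP; split=> [x [j _]|x Ux].
    by rewrite sE => -[].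
  by exists (sg x i) => //; rewrite sE.
have rW (i k : 'I_n) : (r @` W i `&` r @` W k) !=set0 -> i = k.
  move=> [_ [[g [j _ [Yg [_ /= gi]]] <-] [h [j' _ [Yh [_ /= hk]]] /esym gh]]].
  have [e e'] := Yinj _ _ _ _ Yg Yh gh; rewrite e' e in gi.
  by apply: (@perm_inj _ (sg (s h))); rewrite gi hk.
pose M i := bisection_mul (W i) (U i).
have sM i : s @` M i = s @` U i by rewrite src_bisection_mul // sW.
have rM i : r @` M i = r @` W i by rewrite rng_bisection_mul // sW.
have cM i : cob (M i) by exact: cob_mul.
(* [N_i] carries [r(Y_i)] back to [s(U_i)], then by [U_i] to [r(U_i)], then to [r(W_i)]. *)
pose N i := bisection_mul (M i) (inv @^-1` (Y i)).
have cN i : cob (N i) by apply: cob_mul => //; exact: bisection_inv.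
have sN i : s @` N i = r @` Y i.
  by rewrite src_bisection_mul ?src_ginv_image // rng_ginv_image sM sY.
have rN i : r @` N i = r @` W i.
  by rewrite rng_bisection_mul ?rM // rng_ginv_image sM sY.
have clsN i : cls (ones (N i)) =
    cls (ones (W i)) + cls (ones (U i)) - cls (ones (Y i)).
  rewrite cls_mul //; [|exact: bisection_inv|by rewrite rng_ginv_image sM sY].
  by rewrite cls_inv // cls_mul.
have [||cL clsL] := cob_bigcup cN.
- move=> i k _ _ [x []]; rewrite !sN => -[g Yg <-] [h Yh /esym gh].
  by case: (Yinj _ _ _ _ Yg Yh gh).
- by move=> i k _ _; rewrite !rN; exact: rW.
set L := \bigcup_i N i in cL clsL.
(* The [W_i] and the [Y_j] both decompose into all the [E i j], so their classes cancel in the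
   total. *)
have clsLU : cls (ones L) = cls z.
  rewrite clsL clsU; under eq_bigr do rewrite clsN clsW.
  rewrite !big_split /= sumrN exchange_big /=.
  under [X in X + _ - _]eq_bigr do rewrite -clsY.
  by rewrite addrAC subrr add0r.
have sL : s @` L = r @` L.
  rewrite !image_bigcup; under eq_bigcupr do rewrite sN.
  under [RHS]eq_bigcupr do rewrite rN.
  rewrite -!image_bigcup; congr (r @` _).
  apply/seteqP; split=> g.
    by move=> [j _]; rewrite YE => -[i _ Eg]; exists i => //; exists j.
  by move=> [i _ [j _ Eg]]; exists j => //; rewrite YE; exists i.
(* Units off [s(L)] complete [L] to a full G-set without changing its class. *)
have cB := clopenC setT (cob_src_clopen cL).
set B := ~` (s @` L) in cB.
have cLB : cob (L `|` units_on B).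
  apply: cobU => //; first exact: cob_units_on.
    by rewrite src_units_on setICr.
  by rewrite rng_units_on -sL setICr.
have fLB : full_bisection (L `|` units_on B).
  split=> //; rewrite image_setU ?src_units_on ?rng_units_on -?sL setUv //.
have [f fP] := theta_exists fLB.
have ff : full_group_set f.
  by split; [exact: theta_homeomorphism fLB fP | exists (L `|` units_on B)].
exists (exist _ f (mem_set ff)); rewrite (full_index_theta fLB) //.
apply/class1_eq; rewrite bisection_cycleE cls_onesU //; last first.
- rewrite -subset0 => g [Lg [x Bx xg]]; apply: Bx.
  by exists g => //; rewrite -xg src_unit.
- exact: cob_units_on.
by rewrite cls_units_on // addr0.
Qed.

End Surjectivity.

(** * The exact sequence *)

Theorem theorem4p4 (G : cantor_groupoid) :
  minimal_groupoid G -> purely_infinite G -> property_TR G ->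
  (exists (j : {additive tensor (H0 G) 'Z_2 -> abelianization (full_group G)})
          (I : {additive abelianization (full_group G) -> H1 G}),
    [/\ (forall f : Cc (unit_space G),
          exists n (U : 'I_n -> set G) (t : 'I_n -> full_group G),
            tau_choice f U t),
        (forall (f : Cc (unit_space G)) n (U : 'I_n -> set G)
                (t : 'I_n -> full_group G), tau_choice f U t ->
          j (tens (class0 f) (1 : 'Z_2)) = abel (\prod_(i < n) t i)%g),
        (forall f : full_group G, I (abel f) = full_index f),
        exact_at j I &
        range I = [set: H1 G]])
  /\ (two_divisible (H0 G) ->
      exists phi : {additive abelianization (full_group G) -> H1 G},
        bijective phi).
Proof.
move=> Gmin Gpi GTR.
have [mu mmu] := tau_measure_exists Gmin Gpi; have [muE _ _ _] := mmu.
have [j0 j0E] := H0_lift mmu.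
have [I IE] := abel_lift (@full_indexM G).
have class0P a : exists f : Cc (unit_space G), a = class0 f.
  by exists (repr a); rewrite /class0 reprK.
have j02 a : j0 a + j0 a = 0.
  have [f ->] := class0P a; rewrite j0E; have [_ _ mu2 _] := mmu.
  exact/mu2/odd_set_clopen.
(* Only the parity of a multiple of [j0 a] matters, which makes [j0 a *+ b] additive in
   [b : 'Z_2]. *)
have j0n a n : j0 a *+ n = j0 a *+ (n %% 2).
  by rewrite {1}(divn_eq n 2) mulrnDr mulrnA -mulrnAC mulr2n j02 mul0rn add0r.
have [j jE] :
    exists j : {additive tensor (H0 G) 'Z_2 -> abelianization (full_group G)},
    forall a (b : 'Z_2), j (tens a b) = j0 a *+ b.
  apply: (@tens_lift _ _ _ (fun a (b : 'Z_2) => j0 a *+ b)).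
    by move=> a a' b; rewrite raddfD mulrnDl.
  by move=> a b b'; rewrite -mulrnDr [RHS]j0n.
(* Every value of [j0] is the class of a product of elements [tau_U], whose indices are 0. *)
have Ij0 a : I (j0 a) = 0.
  have [f ->] := class0P a; rewrite j0E.
  have [n [U [t tc]]] := tau_choice_exists Gmin Gpi f.
  rewrite -(abel_tau_choice mmu tc) (big_morph _ (@abelM _) (@abel1 _)) raddf_sum.
  apply: big1 => i _; rewrite IE; have [UP _ _] := tc; have [cU U0 ti] := UP i.
  exact: full_index_tau ti.
(* By property TR, and since the image of [j] is a subgroup, only transpositions need a preimage;
   [tau_U] comes from the indicator of [s(U)]. *)
have kerI f : full_index f = 0 -> exists x, j x = abel f.
  move=> f0; have : group_generated (@transposition G) f by rewrite -GTR.
  move=> /(_ [set g | exists x, j x = abel g]); apply; split; first split.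
  - by exists 0; rewrite raddf0 abel1.
  - move=> g h [x xg] [y yh]; exists (x - y).
    by rewrite raddfB xg yh abelM abelV.
  - move=> t /transposition_tau[U fU tU].
    have cs := cob_src_clopen fU.1.
    exists (tens (class0 (chi (@unit_space_hausdorff G) (@src G @` U))) 1).
    by rewrite jE mulr1n j0E odd_mu_chi // (muE _ _ fU tU).
have surjI (q : H1 G) : exists a, I a = q.
  by have [f <-] := full_index_surj Gmin Gpi q; exists (abel f).
split.
  exists j, I; split=> //.
  - exact: tau_choice_exists.
  - by move=> f n U t tc; rewrite jE mulr1n j0E (abel_tau_choice mmu tc).
  - apply/seteqP; split=> [_ [x _ <-]|a /=].
      apply: (@tens_ind _ _ _ (I \o j)) => a b /=.
      by rewrite jE raddfMn /= Ij0 mul0rn.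
    have [f ->] := abel_surj a; rewrite IE => /kerI[x xf].
    by exists x.
  - by apply/seteqP; split=> // q _; have [a <-] := surjI q; exists a.
move=> div2; exists I.
(* A pure tensor with first factor [2c] goes to a multiple of [2 j0(c) = 0], so [j] vanishes and
   exactness makes [I] injective. *)
have j_0 x : j x = 0.
  apply: tens_ind => a b; have [c ->] := div2 a.
  by rewrite jE raddfMn /= mulr2n j02 mul0rn.
have Iinj : injective I.
  move=> a b ab; apply/eqP; rewrite -subr_eq0; have [f fE] := abel_surj (a - b).
  have [|x] := kerI f; first by rewrite -IE -fE raddfB ab subrr.
  by rewrite j_0 fE => <-.
have [K KE] := choice surjI.
by exists K => [a|q]; [apply: Iinj|]; rewrite KE.
Qed.
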